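(* Let $G$ be a 2-connected outerplanar graph that is not an odd cycle. Then $G$ is 5-truncated degree-AT, i.e. $G$ has an AT-orientation $D$ such that $d_D^+(v) \le \min\{5, d_G(v)\} - 1$ for every vertex $v$ of $G$.
   Context: Let $D$ be an orientation of a graph $G$. For a subset $H$ of arcs of $D$, $D[H]$ is the subdigraph formed by the arcs of $H$; it is an Eulerian subdigraph if $d^+_{D[H]}(v)=d^-_{D[H]}(v)$ for every vertex $v$ (the empty arc set counts). Let $\mathcal{E}_e(D)$ (resp. $\mathcal{E}_o(D)$) be the set of arc sets $H$ with $D[H]$ Eulerian and $|H|$ even (resp. odd). $D$ is an AT-orientation (Alon–Tarsi orientation) if $|\mathcal{E}_e(D)| \ne |\mathcal{E}_o(D)|$. For $f: V(G)\to\mathbb{N}$, $G$ is $f$-AT if it has an AT-orientation $D$ with $d_D^+(v)\le f(v)-1$ for every vertex $v$. For a positive integer $k$, $G$ is $k$-truncated degree-AT if $G$ is $f$-AT for $f(v)=\min\{k,d_G(v)\}$. *)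

(* Defs.v *)
From mathcomp Require Import all_boot all_fingroup.
Set Implicit Arguments.
Unset Strict Implicit.
Unset Printing Implicit Defensive.

(* A finite simple graph is a symmetric irreflexive relation e on a finType. *)

Section Graphs.
Variables (T : finType) (e : rel T).

Definition simple_graph : Prop := symmetric e /\ irreflexive e.

Definition deg (v : T) : nat := #|[set u | e v u]|.

Definition induced_connected (A : {set T}) : Prop :=
  {in A &, forall x y,
     connect [rel u w | [&& u \in A, w \in A & e u w]] x y}.

Definition k_connected (k : nat) : Prop :=
  k < #|T| /\ forall X : {set T}, #|X| < k -> induced_connected (~: X).

Definition is_cycle_graph (n : nat) : Prop :=
  2 < n /\ exists f : 'I_n -> T, bijective f /\
    forall i j : 'I_n, e (f i) (f j) = (ordS i == j) || (ordS j == i).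

Definition is_odd_cycle : Prop := exists n, odd n /\ is_cycle_graph n.

End Graphs.

(* Embeddings of graphs on the sphere are represented by rotation systems
   (combinatorial maps): at each vertex v, the clockwise cyclic order of the
   edges at v, given as a permutation [rho v] acting cyclically on the
   neighbours of v (its values elsewhere are irrelevant).  The facial walks are
   the orbits of the dart permutation "traverse u -> v, then leave v along the
   edge that follows vu", and the embedding is spherical iff Euler's formula
   holds. *)

Section Outerplanar.
Variables (T : finType) (e : rel T).

Definition darts : {set T * T} := [set a | e a.1 a.2].

Definition edges : {set {set T}} := [set [set a.1; a.2] | a in darts].

Definition non_isolated : {set T} := [set v | 0 < deg e v].

Definition rotation_system (rho : T -> {perm T}) : Prop :=
  forall v u w : T, e v u -> e v w = (w \in porbit (rho v) u).

Definition face_step (rho : T -> {perm T}) (a : T * T) : T * T :=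
  (a.2, rho a.2 a.1).

Definition face_of (rho : T -> {perm T}) (a : T * T) : {set T * T} :=
  [set b | fconnect (face_step rho) a b].

Definition faces (rho : T -> {perm T}) : {set {set T * T}} :=
  [set face_of rho a | a in darts].

(* V - E + F = 2 summed over the connected components that contain an edge
   (an isolated vertex carries no dart, hence no facial walk; it can be placed
   anywhere).  Each component satisfies V - E + F <= 2, so the equality says
   that every component is embedded on the sphere. *)
Definition planar_rotation (rho : T -> {perm T}) : Prop :=
  rotation_system rho /\
  #|non_isolated| + #|faces rho| = #|edges| + 2 * n_comp e non_isolated.

(* The boundary of the outer face of a plane graph consists of one facial walk
   of each component having an edge: O is the set of these walks. *)
Definition outer_walks (rho : T -> {perm T}) (O : {set {set T * T}}) : Prop :=
  O \subset faces rho /\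
  {in O &, forall A B : {set T * T}, forall a b : T * T,
     a \in A -> b \in B -> connect e a.1 b.1 -> A = B}.

Definition outerplanar : Prop :=
  exists (rho : T -> {perm T}) (O : {set {set T * T}}),
    [/\ planar_rotation rho, outer_walks rho O &
        forall v, v \in non_isolated ->
          exists A a, [/\ A \in O, a \in A & a.1 = v]].

End Outerplanar.

(* The pair (x, y) is the arc from x to y; digraphs are sets of arcs. *)

Section AlonTarsi.
Variable T : finType.
Implicit Types D H : {set T * T}.

Definition outdeg D (v : T) : nat := #|[set a in D | a.1 == v]|.
Definition indeg D (v : T) : nat := #|[set a in D | a.2 == v]|.

Definition orientation (e : rel T) D : Prop :=
  (forall x y, (x, y) \in D -> e x y) /\
  (forall x y, e x y -> ((x, y) \in D) (+) ((y, x) \in D)).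

Definition eulerian H : bool := [forall v, outdeg H v == indeg H v].

Definition even_eulerian D : {set {set T * T}} :=
  [set H : {set T * T} | [&& H \subset D, eulerian H & ~~ odd #|H|]].

Definition odd_eulerian D : {set {set T * T}} :=
  [set H : {set T * T} | [&& H \subset D, eulerian H & odd #|H|]].

Definition AT_orientation (e : rel T) D : Prop :=
  orientation e D /\ #|even_eulerian D| <> #|odd_eulerian D|.

(* [outdeg D v < f v] is outdeg D v <= f v - 1 read in the integers, so that
   f v = 0 is not satisfiable. *)
Definition f_AT (e : rel T) (f : T -> nat) : Prop :=
  exists D, AT_orientation e D /\ forall v, outdeg D v < f v.

Definition truncated_degree_AT (k : nat) (e : rel T) : Prop :=
  f_AT e (fun v => minn k (deg e v)).

End AlonTarsi.

(* Main.v *)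
Require Import Defs.
From mathcomp Require Import all_boot all_fingroup.
From mathcomp Require Import all_order all_algebra zify ring.
Set Implicit Arguments.
Unset Strict Implicit.
Unset Printing Implicit Defensive.
Import GRing.Theory.

(* By Alon and Tarsi, an orientation D with outdegree sequence t is an
   AT-orientation iff the monomial x^t has a nonzero coefficient in the graph
   polynomial prod_(uv) (x_u - x_v), so a monomial with exponents
   t(v) < min(5, deg v) is sought.

   Euler's formula implies that the cycle space mod 2 is spanned by the facial
   walks, a discrete Jordan curve theorem.  With 2-connectivity it gives that the
   outer walk visits every vertex exactly once and that chords do not cross.  The
   graph is then built from single edges by two operations on networks with
   terminals x, y: gluing in series at a vertex p, and adding the edge xy.  Fixing
   the exponents of the inner vertices leaves a binary form in x, y.  Adding the
   edge multiplies the form by x - y; gluing with p^tau multiplies the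
   coefficients of the two forms entrywise after a shift by tau.  Six types of
   forms are enough to carry an induction, and each of them except the one of the
   odd cycle yields an admissible monomial for the closed network. *)

(** * The graph polynomial: bounds on exponents and a product rule at a cut vertex *)

Section GraphPolynomial.
Local Open Scope ring_scope.
Variable T : finType.
Implicit Types (t : {ffun T -> nat}) (l : seq (T * T)) (U V : {set T}).

Definition lower (v : T) t : {ffun T -> nat} := [ffun w => (t w - (w == v))%N].

(* The coefficient of the monomial prod_v x_v^(t v) in the graph polynomial
   prod_((u, v) in l) (x_u - x_v). *)
Fixpoint gcoef l t : int :=
  if l is a :: l' then
    (if (0 < t a.1)%N then gcoef l' (lower a.1 t) else 0)
    - (if (0 < t a.2)%N then gcoef l' (lower a.2 t) else 0)
  else (t == [ffun=> 0%N])%:R.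

Lemma sum_lower v t U :
  (0 < t v)%N -> (\sum_(w in U) t w = (v \in U) + \sum_(w in U) lower v t w)%N.
Proof.
move=> tv; have [vU|vU] := boolP (v \in U).
  rewrite (bigD1 v) //= [in RHS](bigD1 v) //= ffunE eqxx addnA subnKC //.
  by congr addn; apply: eq_bigr => w /andP[_ wv]; rewrite ffunE (negbTE wv) subn0.
rewrite add0n; apply: eq_bigr => w wU; rewrite ffunE.
by case: eqP wU vU => [-> ->//|_ _ _]; rewrite subn0.
Qed.

(** Each edge contributes the variable of one of its ends: an edge inside [U] always contributes to
    [U], and an edge disjoint from [U] never does. *)
Lemma gcoef_bounds l t U : gcoef l t != 0 ->
  (count (fun a => (a.1 \in U) && (a.2 \in U)) l <= \sum_(v in U) t v
     <= count (fun a => (a.1 \in U) || (a.2 \in U)) l)%N.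
Proof.
elim: l t => [|[u v] l IH] t /=.
  case: (t =P _) => [-> _|_]; last by rewrite eqxx.
  by rewrite big1 // => w _; rewrite ffunE.
have [tu|_] := ltnP 0%N (t u).
  have [/eqP h|/IH + _] := boolP (gcoef l (lower u t) == 0).
    rewrite h sub0r oppr_eq0; case: ltnP => // tv /IH.
    by rewrite (sum_lower U tv); lia.
  by rewrite (sum_lower U tu); lia.
rewrite sub0r oppr_eq0; case: ltnP => // tv /IH.
by rewrite (sum_lower U tv); lia.
Qed.

Definition ends_in l U := all (fun a => (a.1 \in U) && (a.2 \in U)) l.

(** The exponents on [U1] away from [p] can only come from [l1], so the degree of [l1] fixes how the
    exponent of [p] is shared, and a single pair of monomials contributes. *)
Lemma gcoef_cat l1 l2 U1 U2 p t1 t2 :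
  ends_in l1 U1 -> ends_in l2 U2 ->
  (forall v, v \in U1 -> v \in U2 -> v = p) ->
  (forall v, v \notin U1 -> t1 v = 0%N) ->
  (forall v, v \notin U2 -> t2 v = 0%N) ->
  (\sum_v t1 v = size l1)%N ->
  gcoef (l1 ++ l2) [ffun v => (t1 v + t2 v)%N] = gcoef l1 t1 * gcoef l2 t2.
Proof.
move=> + e2 U12 + t2U2.
elim: l1 t1 => [|[u v] l1 IH] t1 /=.
  move=> _ _ /eqP; rewrite sum_nat_eq0 => /forallP t10.
  have -> : t1 = [ffun=> 0%N] by apply/ffunP => v; rewrite ffunE; apply/eqP/(t10 v).
  by rewrite eqxx mul1r; congr gcoef; apply/ffunP => v; rewrite !ffunE.
case/andP=> /andP[uU vU] e1 t1U1 st1.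
suff key w : w \in U1 ->
    (if (0 < (t1 w + t2 w))%N then gcoef (l1 ++ l2) (lower w [ffun z => (t1 z + t2 z)%N]) else 0)
    = (if (0 < t1 w)%N then gcoef l1 (lower w t1) else 0) * gcoef l2 t2.
  by rewrite !ffunE !key // mulrBl.
move=> wU1; have [t1w|] := ltnP 0%N (t1 w).
  rewrite ltn_addr // -IH //.
  - congr gcoef; apply/ffunP => z; rewrite !ffunE.
    by case: eqP => [->|_]; lia.
  - by move=> z /t1U1 t1z; rewrite ffunE t1z.
  - have sumT (f : T -> nat) : (\sum_z f z = \sum_(z in [set: T]) f z)%N.
      by apply: eq_bigl => z; rewrite inE.
    by move: st1; rewrite !sumT (sum_lower _ t1w) inE => -[].
rewrite leqn0 => /eqP t1w; rewrite t1w add0n mul0r.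
case: ltnP => // t2w.
have wp : w = p.
  by apply: U12 => //; apply/negPn/negP => /t2U2 t2w0; rewrite t2w0 in t2w.
(* An edge of the first list is charged to [p] although [t1] gives [p] nothing: the exponents on
   [U1 :\ p] then exceed the number of remaining edges meeting it. *)
apply/eqP/negPn/negP => /(gcoef_bounds (U1 :\ p)) /andP[_].
rewrite count_cat [X in (_ + X)%N](_ : _ = 0%N).
  rewrite addn0 => /leq_trans /(_ (count_size _ _)).
  rewrite leqNgt => /negP; apply.
  rewrite -[size l1]/(size l1).+1.-1 -ltnS prednK // -st1.
  rewrite (bigID (mem (U1 :\ p))) /= [X in (_ + X)%N]big1 ?addn0; last first.
    by move=> z; rewrite !inE negb_and negbK => /orP[/eqP->|/t1U1//]; rewrite -wp.
  rewrite ltnS leq_sum // => z; rewrite !inE !ffunE => /andP[zp zU1].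
  by rewrite wp (negbTE zp) subn0 leq_addr.
apply/eqP; rewrite eqn0Ngt -has_count; apply/hasPn => -[a b] /(allP e2) /= /andP[aU bU].
rewrite !inE negb_or !negb_and !negbK.
by apply/andP; split; rewrite orbC -implybE; apply/implyP => h; apply/eqP/U12.
Qed.

End GraphPolynomial.

(** * Two-terminal networks and the binary forms they realize *)

Section Networks.
Local Open Scope ring_scope.
Variable T : finType.
Implicit Types (t : {ffun T -> nat}) (l : seq (T * T)) (V : {set T}).
Implicit Types (al be : seq int).

Definition ldeg l (v : T) : nat :=
  (count (fun a => a.1 == v) l + count (fun a => a.2 == v) l)%N.

Definition place t (x : T) a (y : T) b : {ffun T -> nat} :=
  [ffun v => (t v + (v == x) * a + (v == y) * b)%N].

Definition network l V (x y : T) : Prop :=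
  [/\ x != y, x \in V, y \in V & ends_in l V].

(* The network l has vertex set V and terminals x, y.  For some choice t of
   admissible exponents of the inner vertices, the coefficient of the inner
   monomial in the graph polynomial of l is the form
   sum_a al`_a x^a y^(d - a), where d = (size al).-1. *)
Definition realizes l V (x y : T) al : Prop :=
  exists t,
    [/\ forall v, [|| v \notin V, v == x | v == y] -> t v = 0%N,
        forall v, v \in V -> v != x -> v != y -> (t v < minn 5 (ldeg l v))%N,
        (0 < size al)%N, (\sum_v t v + (size al).-1 = size l)%N &
        forall a, (a < size al)%N ->
          gcoef l (place t x a y ((size al).-1 - a)) = al`_a].

(** Put [d = (size al).-1]. If the first network takes x^a, homogeneity gives it p^(d - a), so the
    second takes p^(a + tau - d); the test guards the truncated subtraction. *)
Definition series_form tau al be : seq int :=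
  mkseq (fun a => if ((size al).-1 <= a + tau)%N
                  then al`_a * be`_(a + tau - (size al).-1) else 0)
        ((size al + size be).-1 - tau).

(** The product with [x - y]; the default value 0 of the list serves at the top index. *)
Definition closed_form al : seq int :=
  mkseq (fun a => (if a is a'.+1 then al`_a' else 0) - al`_a) (size al).+1.

Lemma ldeg_cat l1 l2 v : ldeg (l1 ++ l2) v = (ldeg l1 v + ldeg l2 v)%N.
Proof. by rewrite /ldeg !count_cat addnACA. Qed.

Lemma ends_inW l V V' : V \subset V' -> ends_in l V -> ends_in l V'.
Proof.
by move=> /subsetP sV; apply: sub_all => a /andP[/sV -> /sV ->].
Qed.

Lemma ldeg_out l V v : ends_in l V -> v \notin V -> ldeg l v = 0%N.
Proof.
move=> /allP lV vV; apply/eqP; rewrite addn_eq0 !eqn0Ngt -!has_count.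
by apply/andP; split; apply/hasPn => a /lV /andP[a1 a2]; apply: contra vV => /eqP <-.
Qed.

Lemma sum_place t x a y b :
  (\sum_v place t x a y b v = \sum_v t v + a + b)%N.
Proof.
under eq_bigr do rewrite ffunE.
rewrite !big_split /= -!big_distrl /= ; congr (_ + _ + _)%N.
  by rewrite (bigD1 x) //= eqxx big1 ?mul1n // => v /negbTE ->.
by rewrite (bigD1 y) //= eqxx big1 ?mul1n // => v /negbTE ->.
Qed.

Lemma network_cat l1 V1 l2 V2 x p y :
  network l1 V1 x p -> network l2 V2 p y -> V1 :&: V2 = [set p] ->
  network (l1 ++ l2) (V1 :|: V2) x y.
Proof.
move=> [xp xV1 pV1 e1] [py pV2 yV2 e2] V12; split; rewrite ?inE ?xV1 ?yV2 ?orbT //.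
  apply: contra py => /eqP xy; have : y \in V1 :&: V2 by rewrite inE yV2 -xy xV1.
  by rewrite V12 inE eq_sym.
rewrite /ends_in all_cat; apply/andP; split.
  by apply: ends_inW e1; rewrite subsetUl.
by apply: ends_inW e2; rewrite subsetUr.
Qed.

Lemma realizes_series l1 V1 l2 V2 x p y al be tau :
  network l1 V1 x p -> network l2 V2 p y -> V1 :&: V2 = [set p] ->
  realizes l1 V1 x p al -> realizes l2 V2 p y be ->
  (tau < minn 5 (ldeg l1 p + ldeg l2 p))%N ->
  (tau.+1 < size al + size be)%N ->
  realizes (l1 ++ l2) (V1 :|: V2) x y (series_form tau al be).
Proof.
move=> n1 n2 V12 [t1 [t1V t1b al0 s1 c1]] [t2 [t2V t2b be0 s2 c2]] taub taus.
have [xy _ _ _] := network_cat n1 n2 V12.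
move: n1 n2 => [xp xV1 pV1 e1] [py pV2 yV2 e2].
have V12p v : v \in V1 -> v \in V2 -> v = p.
  by move=> v1 v2; apply/set1P; rewrite -V12 inE v1.
have xV2 : x \notin V2 by apply: contra xp => xV2; rewrite (V12p x).
have yV1 : y \notin V1 by apply: contra py => yV1; rewrite (V12p y).
have st : size (series_form tau al be) = ((size al + size be).-1 - tau)%N.
  exact: size_mkseq.
pose t := [ffun v => (t1 v + t2 v + (v == p) * tau)%N].
exists t; split.
- move=> v vV; rewrite ffunE t1V ?t2V.
  + case: (v =P p) vV => [->|_ _ //].
    by rewrite in_setU pV1 [p == x]eq_sym (negbTE xp) (negbTE py).
  + by case/or3P: vV => [|/eqP->|->]; rewrite ?orbT ?xV2 // inE negb_or => /andP[_ ->].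
  + by case/or3P: vV => [|->|/eqP->]; rewrite ?orbT ?yV1 // inE negb_or => /andP[->].
- move=> v vV vx vy; rewrite ffunE ldeg_cat.
  case: (v =P p) => [->|/eqP vp].
    by rewrite t1V ?t2V ?eqxx ?orbT // mul1n !add0n.
  rewrite mul0n addn0; move: vV; rewrite inE => /orP[v1|v2].
    have v2 : v \notin V2 by apply: contra vp => v2; rewrite (V12p v).
    rewrite (t2V v) ?v2 // addn0; apply: leq_trans (t1b v v1 vx vp) _.
    by rewrite leq_min geq_minl /=; apply: leq_trans (geq_minr _ _) (leq_addr _ _).
  have v1 : v \notin V1 by apply: contra vp => v1; rewrite (V12p v).
  rewrite (t1V v) ?v1 // add0n; apply: leq_trans (t2b v v2 vp vy) _.
  by rewrite leq_min geq_minl /=; apply: leq_trans (geq_minr _ _) (leq_addl _ _).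
- by move: taus; rewrite st; clear; lia.
- rewrite st size_cat.
  have -> : (\sum_v t v = \sum_v t1 v + \sum_v t2 v + tau)%N.
    under eq_bigr do rewrite ffunE.
    rewrite !big_split /= -big_distrl /=; congr (_ + _)%N.
    by rewrite (bigD1 p) //= eqxx big1 ?mul1n // => v /negbTE ->.
  by move: s1 s2 taus al0 be0; clear; lia.
rewrite st => a ad; rewrite nth_mkseq //.
set F := place _ _ _ _ _.
have FV1 v : v \in V1 -> v != p -> F v = (t1 v + (v == x) * a)%N.
  move=> v1 vp; rewrite !ffunE (negbTE vp) (t2V v).
    have /negbTE -> : v != y by apply: contraNneq yV1 => <-.
    by rewrite mul0n !addn0.
  by rewrite (contra _ vp) // => v2; rewrite (V12p v).
have sumV1 : (\sum_(v in V1 :\ p) F v = \sum_v t1 v + a)%N.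
  rewrite -[RHS]addn0 -(sum_place t1 x a p 0) [RHS](bigID (mem (V1 :\ p))) /=.
  rewrite [X in _ = (_ + X)%N]big1 ?addn0 => [|v].
    apply: eq_bigr => v; rewrite !inE => /andP[vp v1].
    by rewrite FV1 // !ffunE muln0 addn0.
  rewrite !inE negb_and negbK !ffunE muln0 addn0 => /orP[/eqP->|v1].
    by rewrite t1V ?eqxx ?orbT // eq_sym (negbTE xp).
  rewrite t1V ?v1 //; suff /negbTE -> : v != x by [].
  by apply: contraNneq v1 => ->.
have c1size : (count (fun a0 => (a0.1 \in V1 :\ p) || (a0.2 \in V1 :\ p)) (l1 ++ l2)
   <= size l1)%N.
  rewrite count_cat [X in (_ + X)%N](_ : _ = 0%N) ?addn0 ?count_size //.
  apply/eqP; rewrite eqn0Ngt -has_count; apply/hasPn => -[u v] /(allP e2) /= /andP[uU vU].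
  rewrite !inE negb_or !negb_and !negbK.
  by apply/andP; split; rewrite orbC -implybE; apply/implyP => h; apply/eqP/V12p.
have c1all : (size l1 <= count (fun a0 => (a0.1 \in V1) && (a0.2 \in V1)) (l1 ++ l2))%N.
  by rewrite count_cat; move: e1; rewrite /ends_in all_count => /eqP ->; rewrite leq_addr.
(* Beyond the degree of [al], the vertices of [V1 :\ p] would need more edges than [l1] has. *)
have [ada|ada] := leqP a (size al).-1; last first.
  have als : (size al <= a)%N by move: al0 ada; clear; lia.
  rewrite [al`_a]nth_default // mul0r if_same; apply/eqP/negPn/negP.
  by move=> /(gcoef_bounds (V1 :\ p)) /andP[_]; move: c1size s1 ada; rewrite sumV1; clear; lia.
have Fp : F p = tau.
  by rewrite !ffunE t1V ?t2V ?eqxx ?orbT // (negbTE py) eq_sym (negbTE xp) !mul0n mul1n !addn0.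
(* If [tau] is too small, the edges inside [V1] outnumber the exponents available there. *)
have [dk|dk] := leqP (size al).-1 (a + tau); last first.
  apply/eqP/negPn/negP => /(gcoef_bounds V1) /andP[+ _].
  rewrite (bigD1 p) //= Fp (eq_bigl (fun v => v \in V1 :\ p)); last first.
    by move=> v; rewrite !inE andbC.
  by move: c1all s1 dk; rewrite sumV1; clear; lia.
rewrite -c1; last by move: ada al0; clear; lia.
rewrite -c2; last by move: ad dk be0; clear; lia.
rewrite -(gcoef_cat e1 e2 V12p).
- congr gcoef; apply/ffunP => v; rewrite !ffunE.
  by case: (v =P p) => [_|_]; move: ad ada dk al0 be0; clear; lia.
- move=> v v1; rewrite !ffunE t1V ?v1 //.
  have /negbTE -> : v != x by apply: contraNneq v1 => ->.
  by have /negbTE -> : v != p by apply: contraNneq v1 => ->.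
- move=> v v2; rewrite !ffunE t2V ?v2 //.
  have /negbTE -> : v != y by apply: contraNneq v2 => ->.
  by have /negbTE -> : v != p by apply: contraNneq v2 => ->.
- by rewrite sum_place; move: s1 ada; clear; lia.
Qed.

Lemma realizes_close l V x y al : x != y ->
  realizes l V x y al -> realizes ((x, y) :: l) V x y (closed_form al).
Proof.
move=> xy [t [tV tb al0 s c]]; have yx : y != x by rewrite eq_sym.
exists t; split=> //.
- move=> v vV vx vy; apply: leq_trans (tb v vV vx vy) _.
  rewrite leq_min geq_minl /=; apply: leq_trans (geq_minr _ _) _.
  by rewrite /ldeg /=; lia.
- by rewrite size_mkseq /=; lia.
rewrite size_mkseq => a ad; rewrite nth_mkseq //= !ffunE !eqxx.
rewrite (negbTE xy) (negbTE yx) (tV x) ?eqxx ?orbT // (tV y) ?eqxx ?orbT //.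
rewrite !mul1n !mul0n !add0n !addn0; congr (_ - _).
  case: a ad => [//|a] ad /=; rewrite -c; last by lia.
  congr gcoef; apply/ffunP => v; rewrite !ffunE.
  case: (v =P x) => [->|_]; rewrite ?(negbTE xy) /=; last by lia.
  by lia.
case: ltnP => h; last by rewrite nth_default //; lia.
rewrite -c; last by lia.
congr gcoef; apply/ffunP => v; rewrite !ffunE.
by case: (v =P y) => [->|_]; rewrite ?(negbTE yx) /=; lia.
Qed.

Lemma realizes_edge x y : x != y -> realizes [:: (x, y)] [set x; y] x y [:: -1; 1].
Proof.
move=> xy; exists [ffun=> 0%N]; split=> //.
- by move=> v _; rewrite ffunE.
- by move=> v; rewrite !inE => /orP[/eqP->|/eqP->]; rewrite eqxx.
- by rewrite big1 // => v _; rewrite ffunE.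
have yx : y != x by rewrite eq_sym.
have eq0 u w : u != w -> (lower u (place [ffun=> 0%N] u 1 w 0) == [ffun=> 0%N]).
  by move=> uw; apply/eqP/ffunP => v; rewrite !ffunE; case: eqP; case: eqP.
case=> [|[|//]] _ /=; rewrite !ffunE !eqxx (negbTE xy) (negbTE yx) /=.
- rewrite (_ : place _ _ _ _ _ = place [ffun=> 0%N] y 1 x 0) ?eq0 //.
  by apply/ffunP => v; rewrite !ffunE; lia.
- by rewrite eq0.
Qed.

End Networks.

(** * The types of chains and their behaviour under closing and series composition *)

Section Chains.
Local Open Scope ring_scope.
Variable T : finType.
Implicit Types (t : {ffun T -> nat}) (l : seq (T * T)) (V : {set T}).
Implicit Types (al be ga : seq int) (a b c k : int).

(* Forms are listed by increasing powers of x, so [:: b; a] is a x + b y.  The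
   last case is that of a path; closed by the edge xy it is a bare cycle. *)
Inductive good_chain l V (x y : T) : Prop :=
| GoodPure d k of (d <= 2)%N & (d <= ldeg l y)%N & k != 0 &
    realizes l V x y (k :: nseq d 0)
| GoodLeft a b of (1 < ldeg l x)%N & b != 0 & realizes l V x y [:: b; a]
| GoodGeneric a b of (1 < ldeg l y)%N & b != 0 & a != 0 & a != b &
    realizes l V x y [:: b; a]
| GoodEqual b c of (1 < ldeg l y)%N & b != 0 & realizes l V x y [:: b; b] &
    c != 0 & realizes l V x y [:: 0; c; 0]
| GoodSplit a b c k of (1 < ldeg l x)%N & (1 < ldeg l y)%N &
    a != 0 & realizes l V x y [:: 0; a] & b != 0 & realizes l V x y [:: b; c; k]
| GoodPath c of #|V| = (size l).+1 & realizes l V x y [:: (-1) ^+ size l; 1] &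
    c != 0 & realizes l V x y [:: 0; c; 0].

Definition chain l V x y : Prop :=
  [/\ network l V x y, (0 < ldeg l x)%N, (0 < ldeg l y)%N & good_chain l V x y].

(** In the decomposition below, a piece spans an interval of the outer cycle whose ends are
    adjacent; a chain spans an interval of at least three vertices, without any edge between its
    ends. *)
Inductive piece l V (x y : T) : Prop :=
| PieceEdge of x != y & l = [:: (x, y)] & V = [set x; y]
| PieceClosed l' of l = (x, y) :: l' & chain l' V x y.

Definition block l V x y : Prop := piece l V x y \/ chain l V x y.

Lemma ldeg_close l x y : x != y ->
  (ldeg ((x, y) :: l) x = (ldeg l x).+1) * (ldeg ((x, y) :: l) y = (ldeg l y).+1).
Proof.
by move=> xy; rewrite /ldeg /= !eqxx (negbTE xy) eq_sym (negbTE xy) !add0n add1n addnS.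
Qed.

Lemma piece_network l V x y : piece l V x y ->
  [/\ network l V x y, (0 < ldeg l x)%N & (0 < ldeg l y)%N].
Proof.
case=> [xy -> ->|l' -> [[xy xV yV e] dx dy _]].
  split; first by split; rewrite ?/ends_in /= ?inE ?eqxx ?orbT.
    by rewrite /ldeg /= eqxx.
  by rewrite /ldeg /= eqxx addnS.
by rewrite !ldeg_close //; split => //; split=> //; rewrite /ends_in /= xV yV.
Qed.

Lemma block_network l V x y : block l V x y ->
  [/\ network l V x y, (0 < ldeg l x)%N & (0 < ldeg l y)%N].
Proof. by case=> [/piece_network//|[]]. Qed.

(* In LeftEqual the middle coefficient has cancelled, as it does when b x + b y is
   multiplied by x - y. *)
Variant left_profile l V (x y : T) : Prop :=
| LeftPure d k of (d <= 2)%N & (d < ldeg l y)%N & k != 0 &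
    realizes l V x y [:: - k, k & nseq d 0]
| LeftGeneric a b c of (1 < ldeg l x)%N & (1 < ldeg l y)%N &
    b != 0 & a != 0 & realizes l V x y [:: b; a; c]
| LeftEqual b of (1 < ldeg l y)%N & b != 0 & realizes l V x y [:: - b; 0; b]
| LeftSplit a b c k h of (1 < ldeg l x)%N & (2 < ldeg l y)%N & a != 0 & b != 0 &
    realizes l V x y [:: 0; - a; a] & realizes l V x y [:: b; c; k; h].

Lemma close_pure l V x y d k : x != y -> realizes l V x y (k :: nseq d 0) ->
  realizes ((x, y) :: l) V x y [:: - k, k & nseq d 0].
Proof.
move=> xy /(realizes_close xy); congr realizes.
apply: (@eq_from_nth int 0); first by rewrite size_mkseq /= size_nseq.
rewrite size_mkseq => -[|[|i]] h; rewrite nth_mkseq //=.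
- by rewrite sub0r.
- by rewrite nth_nseq if_same subr0.
by rewrite !nth_nseq !if_same subr0.
Qed.

Lemma close2 l V x y a b : x != y -> realizes l V x y [:: b; a] ->
  realizes ((x, y) :: l) V x y [:: - b; b - a; a].
Proof.
move=> xy /(realizes_close xy).
by rewrite (_ : closed_form _ = [:: 0 - b; b - a; a - 0]) // subr0 sub0r.
Qed.

Lemma close3 l V x y a b c : x != y -> realizes l V x y [:: b; a; c] ->
  realizes ((x, y) :: l) V x y [:: - b; b - a; a - c; c].
Proof.
move=> xy /(realizes_close xy).
by rewrite (_ : closed_form _ = [:: 0 - b; b - a; a - c; c - 0]) // subr0 sub0r.
Qed.

(** Closing a linear form [[:: b; a]] creates the middle coefficient [b - a]; whether it vanishes
    separates [LeftEqual] from [LeftGeneric]. *)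
Lemma closed_profile l V x y : chain l V x y ->
  left_profile ((x, y) :: l) V x y.
Proof.
case=> -[xy _ _ _] dx dy g.
have two a b : b != 0 -> realizes l V x y [:: b; a] ->
    left_profile ((x, y) :: l) V x y.
  move=> b0 /(close2 xy) r; case: (eqVneq a b) => [ab|ab].
    by apply: (@LeftEqual _ _ _ _ b); rewrite ?ldeg_close //; rewrite ab subrr in r.
  by apply: LeftGeneric r; rewrite ?oppr_eq0 ?ldeg_close // subr_eq0 eq_sym.
case: g => [d k d2 dd k0 r|a b dl b0|a b dr b0 a0 ab|b c dr b0 r _ _
           |a b c k dl dr a0 r1 b0 r2|c _ r _ _].
- by apply: (LeftPure d2 _ k0 (close_pure xy r)); rewrite ldeg_close.
- exact: two.
- exact: two.
- exact: two r.
- apply: (LeftSplit _ _ a0 _ _ (close3 xy r2)); rewrite ?oppr_eq0 ?ldeg_close //.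
  by have := close2 xy r1; rewrite oppr0 sub0r.
- by apply: two r; rewrite signr_eq0.
Qed.

Lemma piece_profile l V x y : piece l V x y -> left_profile l V x y.
Proof.
case=> [xy -> ->|l' -> /closed_profile//].
apply: (@LeftPure _ _ _ _ 0 1) => //; last exact: realizes_edge.
by rewrite /ldeg /= eqxx addnS.
Qed.

(** When the right terminal becomes an inner vertex, its exponent can absorb this pure power; degree
    at most 3 leaves room below the bound 5. *)
Lemma left_lead l V x y : left_profile l V x y ->
  exists al, [/\ realizes l V x y al, (1 < size al <= 4)%N,
    ((size al).-1 <= ldeg l y)%N & al`_0 != 0].
Proof.
case=> [d k d2 dd k0 r|a b c dx dy b0 a0 r|b dy b0 r|a b c k h dx dy a0 b0 _ r];
  eexists; split; try exact: r; rewrite ?oppr_eq0 //= ?size_nseq; lia.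
Qed.

(** * Gluing two networks at [p] with a chosen exponent [tau] *)

Section Series.
Variables (l1 l2 : seq (T * T)) (V1 V2 : {set T}) (x p y : T).
Hypothesis n1 : network l1 V1 x p.
Hypothesis n2 : network l2 V2 p y.
Hypothesis V12 : V1 :&: V2 = [set p].
Notation l := (l1 ++ l2).
Notation V := (V1 :|: V2).

Let ldegl : ldeg l x = ldeg l1 x.
Proof.
rewrite ldeg_cat (@ldeg_out _ l2 V2) ?addn0 //; first by case: n2.
case: n1 => [xp xV1 _ _]; apply: contra xp => xV2.
by rewrite -in_set1 -V12 inE xV1.
Qed.

Let ldegr : ldeg l y = ldeg l2 y.
Proof.
rewrite ldeg_cat (@ldeg_out _ l1 V1) //; first by case: n1.
case: n2 => [py _ yV2 _]; rewrite eq_sym in py; apply: contra py => yV1.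
by rewrite -in_set1 -V12 inE yV1.
Qed.

Lemma series_realizes tau al be ga :
  realizes l1 V1 x p al -> realizes l2 V2 p y be ->
  (tau < 5)%N -> (tau < ldeg l1 p + ldeg l2 p)%N ->
  (size ga + tau = (size al + size be).-1)%N -> (0 < size ga)%N ->
  (forall i, (i < size ga)%N -> ga`_i =
     if ((size al).-1 <= i + tau)%N then al`_i * be`_(i + tau - (size al).-1) else 0) ->
  realizes l V x y ga.
Proof.
move=> r1 r2 t5 td sg g0 gE.
have := @realizes_series _ _ _ _ _ _ _ _ _ _ tau n1 n2 V12 r1 r2.
rewrite leq_min t5 => /(_ td); have -> : (tau.+1 < size al + size be)%N by lia.
move=> /(_ isT); congr realizes; apply: (@eq_from_nth int 0).
  by rewrite size_mkseq; lia.
by rewrite size_mkseq => i ih; rewrite nth_mkseq // gE //; lia.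
Qed.

(** For [tau = (size al).-1 + m], entry [i] of [al] meets entry [m + i] of [be], which vanishes for
    positive [i]: only the pure power of [y] is left. *)
Lemma series_pure al be m d :
  realizes l1 V1 x p al -> (1 < size al)%N -> ((size al).-1 <= ldeg l1 p)%N ->
  al`_0 != 0 -> (size al + m <= 5)%N ->
  realizes l2 V2 p y be -> size be = (d + m).+1 -> (m < ldeg l2 p)%N ->
  be`_m != 0 -> (forall i, (m < i)%N -> be`_i = 0) ->
  (d <= 2)%N -> (d <= ldeg l2 y)%N -> good_chain l V x y.
Proof.
move=> r1 s1 d1 al0 sm r2 s2 dm bm bz d2 dy.
apply: (@GoodPure _ _ _ _ d (al`_0 * be`_m)) => //; first by rewrite ldegr.
  by rewrite mulf_neq0.
apply: (@series_realizes ((size al).-1 + m) _ _ _ r1 r2); rewrite /= ?size_nseq; try lia.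
case=> [|i] ih /=.
  by rewrite add0n leq_addr addKn.
rewrite nth_nseq if_same; case: ifP => // h.
by rewrite (bz (_ - _)%N) ?mulr0 //; lia.
Qed.

(** The exponent is that of [series_pure], but [be] has exactly one entry above index [m], so a
    linear form is left. *)
Lemma series_lin al be m :
  realizes l1 V1 x p al -> (1 < size al)%N -> ((size al).-1 <= ldeg l1 p)%N ->
  al`_0 != 0 -> (size al + m <= 5)%N -> (1 < ldeg l1 x)%N ->
  realizes l2 V2 p y be -> size be = m.+2 -> (m < ldeg l2 p)%N ->
  be`_m != 0 -> good_chain l V x y.
Proof.
move=> r1 s1 d1 al0 sm dx r2 s2 dm bm.
apply: (@GoodLeft _ _ _ _ (al`_1 * be`_m.+1) (al`_0 * be`_m)).
- by rewrite ldegl.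
- by rewrite mulf_neq0.
apply: (@series_realizes ((size al).-1 + m) _ _ _ r1 r2); rewrite /=; try lia.
case=> [|[|//]] ih /=; first by rewrite add0n leq_addr addKn.
by rewrite addnCA leq_addr addKn.
Qed.

(** The zero in the middle of [[:: - b; 0; b]] spoils [m = 1], and [m = 2] needs a third edge at [p]
    in [l2]. The remedy depends on the first network: pairs of forms, or the extra form in the last
    hypothesis. *)
Lemma series_equal b :
  left_profile l1 V1 x p -> (1 < ldeg l2 p)%N -> (1 < ldeg l2 y)%N ->
  b != 0 -> realizes l2 V2 p y [:: - b; 0; b] ->
  (2 < ldeg l2 p)%N \/ (exists2 c, c != 0 & realizes l2 V2 p y [:: 0; - c; c; 0]) ->
  good_chain l V x y.
Proof.
move=> L dp dy b0 r2 D.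
case: L => [d k d2 dd k0 r|a b' c dx' dp' b'0 a0 r|b' dp' b'0 r|a b' c k h dx' dp' a0 b'0 r r'].
(* The supports of the two forms meet only at index 0, so the power y^2 alone survives. *)
- apply: (@GoodPure _ _ _ _ 2 (k * b)); rewrite ?ldegr ?mulf_neq0 //.
  apply: (@series_realizes d.+1 _ _ _ r r2); rewrite /= ?size_nseq; try lia.
  by case=> [|[|[|//]]] _;
    rewrite /= leq_addl addnK /= ?nth_nseq ?if_same ?mulrNN ?mul0r ?mulr0.
- apply: (@GoodSplit _ _ _ _ (a * b) (b' * - b) 0 (c * b)); rewrite ?ldegr ?ldegl //.
  + by rewrite mulf_neq0.
  + apply: (@series_realizes 3 _ _ _ r r2) => //=; first by lia.
    by case=> [|[|//]] _; rewrite //= mulr0.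
  + by rewrite mulf_neq0 ?oppr_eq0.
  apply: (@series_realizes 2 _ _ _ r r2) => //=; first by lia.
  by case=> [|[|[|//]]] _; rewrite //= mulr0.
- case: D => [dp2|[c c0 r2']].
    apply: (@series_pure [:: - b'; 0; b'] [:: - b; 0; b] 2 0) => //; rewrite ?oppr_eq0 //.
    by move=> i i2; rewrite nth_default.
  (* Exponent 3 shifts by one and pairs [[:: - b'; 0; b']] with [[:: - c; c; 0]]. *)
  apply: (@GoodPure _ _ _ _ 2 (b' * c)); rewrite ?ldegr ?mulf_neq0 //.
  apply: (@series_realizes 3 _ _ _ r r2') => //=; first by lia.
  by case=> [|[|[|//]]] _; rewrite /= ?mulrNN ?mul0r ?mulr0.
- apply: (@GoodSplit _ _ _ _ (- a * b) (b' * - b) 0 (k * b)); rewrite ?ldegr ?ldegl //.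
  + by rewrite mulf_neq0 ?oppr_eq0.
  + apply: (@series_realizes 3 _ _ _ r r2) => //=; first by lia.
    by case=> [|[|//]] _; rewrite //= mulr0.
  + by rewrite mulf_neq0 ?oppr_eq0.
  apply: (@series_realizes 3 _ _ _ r' r2) => //=; first by lia.
  by case=> [|[|[|//]]] _; rewrite //= mulr0.
Qed.

End Series.

(* Unless the second block is closed and of the type [:: - b; 0; b], giving the
   middle vertex p the largest useful exponent always leaves a form in which the
   pure power of y survives. *)
Lemma piece_series l1 l2 V1 V2 x p y :
  piece l1 V1 x p -> block l2 V2 p y -> V1 :&: V2 = [set p] ->
  chain (l1 ++ l2) (V1 :|: V2) x y.
Proof.
move=> P B V12.
have [n1 dx1 dp1] := piece_network P; have [n2 dp2 dy2] := block_network B.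
split; [exact: network_cat n1 n2 V12|by rewrite ldeg_cat ltn_addr|
  by rewrite ldeg_cat ltn_addl|].
have L := piece_profile P; have [al [r1 s1 d1 al0]] := left_lead L.
have {s1} [s1 s1'] := andP s1.
(* The form [al] has degree at most 3, so [m <= 1] keeps the exponent of [p] below 5. *)
have sal m : (m <= 1)%N -> (size al + m <= 5)%N.
  by move=> m1; apply: (@leq_trans (4 + 1)) => //; apply: leq_add.
have pure be m d : (m <= 1)%N -> realizes l2 V2 p y be -> size be = (d + m).+1 ->
    (m < ldeg l2 p)%N -> be`_m != 0 -> (forall i, (m < i)%N -> be`_i = 0) ->
    (d <= 2)%N -> (d <= ldeg l2 y)%N -> good_chain (l1 ++ l2) (V1 :|: V2) x y.
  by move=> m1; apply: (series_pure n1 n2 V12 r1) => //; apply: sal.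
have lin be m : (1 < ldeg l1 x)%N -> (m <= 1)%N -> realizes l2 V2 p y be ->
    size be = m.+2 -> (m < ldeg l2 p)%N -> be`_m != 0 ->
    good_chain (l1 ++ l2) (V1 :|: V2) x y.
  by move=> dx m1; apply: (series_lin n1 n2 V12 r1) => //; apply: sal.
have [py pV2 yV2 _] := n2.
have closed_equal l' b : l2 = (p, y) :: l' -> chain l' V2 p y -> b != 0 ->
    realizes l' V2 p y [:: b; b] ->
    (1 < ldeg l' p)%N \/ (exists2 c, c != 0 & realizes l' V2 p y [:: 0; c; 0]) ->
    good_chain (l1 ++ l2) (V1 :|: V2) x y.
  move=> E2 [_ dp dy _] b0 /(close2 py); rewrite subrr -E2 => r D.
  apply: (series_equal n1 n2 V12 L _ _ b0 r); rewrite ?E2 ?ldeg_close //.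
  case: D => [?|[c c0 r']]; [by left|right; exists c => //].
  by have := close3 py r'; rewrite oppr0 sub0r subr0.
(* The last nonzero coefficient decides: [m = 1] leaves a constant, [m = 0] a multiple of [y]. *)
have chain_left a b : (1 < ldeg l2 p)%N -> b != 0 \/ a != 0 ->
    realizes l2 V2 p y [:: b; a] -> good_chain (l1 ++ l2) (V1 :|: V2) x y.
  move=> dp ba r; have [a0|a0] := eqVneq a 0; last first.
    by apply: (pure _ 1 0%N _ r) => // i i1; rewrite nth_default.
  have b0 : b != 0 by case: ba => //; rewrite a0 eqxx.
  by apply: (pure _ 0%N 1 _ r) => //; case=> [|[|i]] // _; rewrite ?nth_default.
have chain_pure d k : (d <= 2)%N -> (d <= ldeg l2 y)%N -> k != 0 ->
    realizes l2 V2 p y (k :: nseq d 0) -> good_chain (l1 ++ l2) (V1 :|: V2) x y.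
  move=> d2 dy k0 r; apply: (pure _ 0%N d _ r) => //; first by rewrite /= size_nseq addn0.
  by case=> [|i] // _; rewrite /= nth_nseq if_same.
have closed_pure l' d k : l2 = (p, y) :: l' -> (d <= 2)%N -> (d <= ldeg l' y)%N ->
    (0 < ldeg l' p)%N -> k != 0 ->
    realizes l' V2 p y (k :: nseq d 0) -> good_chain (l1 ++ l2) (V1 :|: V2) x y.
  move=> E2 d2 dy dp k0 /(close_pure py); rewrite -E2 => r.
  apply: (pure _ 1%N d _ r) => //; rewrite ?E2 ?ldeg_close //= ?size_nseq ?addn1 //.
    by case=> [|[|i]] // _; rewrite /= nth_nseq if_same.
  exact: leqW.
(* If the first piece is not a bare edge, its left terminal has degree at least 2, as [GoodLeft]
   requires. *)
case: P => [xp El1 EV1|l1' El1 [_ dx _ _]]; last first.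
  have dx' : (1 < ldeg l1 x)%N by rewrite El1 ldeg_close //; case: n1.
  case: B => [[_ E2 EV2|l' E2 C]|C].
  - by apply: (lin [:: -1; 1] 0%N) => //; rewrite E2 EV2; apply: realizes_edge.
  - have two a b : b != 0 -> b != a -> realizes l' V2 p y [:: b; a] ->
        good_chain (l1 ++ l2) (V1 :|: V2) x y.
      move=> b0 ab /(close2 py); rewrite -E2 => r.
      apply: (lin _ 1 dx' _ r) => //; last by rewrite subr_eq0.
      by rewrite E2 ldeg_close //; case: C.
    case: (C) => _ dp dy.
    case=> [d k d2 dd k0 r|a b dl b0 r|a b dr b0 a0 ab r|b c dr b0 r c0 r'
           |a b c k dl dr a0 r b0 r'|c sV r c0 r'].
    + exact: (closed_pure l' d k).
    + case: (eqVneq b a) => [ba|ba]; last exact: two r.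
      by apply: (closed_equal l' b E2 C) => //; [rewrite {2}ba|left].
    + by apply: two r; rewrite // eq_sym.
    + by apply: (closed_equal l' b E2 C) => //; right; exists c.
    + have := close2 py r; rewrite -E2 oppr0 sub0r => r2.
      by apply: (lin _ 1 dx' _ r2); rewrite ?oppr_eq0 // E2 ldeg_close.
    + case: (eqVneq ((-1) ^+ size l') (1 : int)) => [s1E|sN1].
        by rewrite s1E in r; apply: (closed_equal l' 1 E2 C) => //; right; exists c.
      by apply: two r; rewrite // signr_eq0.
  case: (C) => _ dp dy.
  case=> [d k d2 dd k0 r|a b dl b0 r|a b dr b0 a0 ab r|b c dr b0 r c0 r'
         |a b c k dl dr a0 r b0 r'|c sV r c0 r'].
  - exact: chain_pure r.
  - by apply: chain_left r => //; left.
  - exact: (lin _ 0%N dx' _ r).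
  - exact: (lin _ 0%N dx' _ r).
  - by apply: chain_left r => //; right.
  - by apply: (lin _ 0%N dx' _ r) => //=; rewrite signr_eq0.
have {}r1 : realizes l1 V1 x p [:: -1; 1] by rewrite El1 EV1; apply: realizes_edge.
have dp1E : ldeg l1 p = 1%N.
  by rewrite El1 /ldeg /= eqxx (negbTE xp).
have ldr : ldeg (l1 ++ l2) y = ldeg l2 y.
  rewrite ldeg_cat (@ldeg_out _ l1 V1) //; first by case: n1.
  rewrite eq_sym in py; apply: contra py => yV1.
  by rewrite -in_set1 -V12 inE yV1.
have const be m : (m < 4)%N -> realizes l2 V2 p y be -> size be = m.+1 ->
    (m < ldeg l2 p)%N -> be`_m != 0 -> good_chain (l1 ++ l2) (V1 :|: V2) x y.
  move=> m4 r s dm bm.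
  apply: (series_pure n1 n2 V12 r1 (m := m) (d := 0%N) _ _ _ _ r) => //; rewrite ?dp1E //.
  by move=> i mi; rewrite nth_default // s.
(* Exponent 0 at [p] leaves a multiple of [x y], the second form kept in [GoodEqual] and
   [GoodPath]. *)
have xyE a b : realizes l2 V2 p y [:: b; a] ->
    realizes (l1 ++ l2) (V1 :|: V2) x y [:: 0; b; 0].
  move=> r; apply: (series_realizes n1 n2 V12 (tau := 0%N) r1 r) => //.
    by rewrite dp1E.
  by case=> [|[|[|//]]] _; rewrite //= ?mul1r ?mul0r.
have linE a b : realizes l2 V2 p y [:: b; a] ->
    realizes (l1 ++ l2) (V1 :|: V2) x y [:: - b; a].
  move=> r; apply: (series_realizes n1 n2 V12 (tau := 1%N) r1 r) => //.
    by rewrite dp1E.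
  by case=> [|[|//]] _; rewrite /= ?mul1r ?mulN1r.
have path_ext : #|V2| = (size l2).+1 -> realizes l2 V2 p y [:: (-1) ^+ size l2; 1] ->
    good_chain (l1 ++ l2) (V1 :|: V2) x y.
  move=> V2E r; apply: (@GoodPath _ _ _ _ ((-1) ^+ size l2)).
  - by rewrite cardsU V12 cards1 V2E EV1 cards2 xp size_cat El1 /=; lia.
  - rewrite (_ : _ ^+ size (l1 ++ l2) = - (-1) ^+ size l2); first exact: linE.
    by rewrite size_cat El1 exprS mulN1r.
  - by rewrite signr_eq0.
  - exact: xyE r.
(* Exponent 2 at [p] pairs [[:: -1; 1]] with the two top coefficients [b - a] and [a] of the closed
   form. *)
have closedE a b l' : l2 = (p, y) :: l' -> (0 < ldeg l' p)%N -> (0 < ldeg l' y)%N ->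
    b != 0 -> a != 0 -> a != b -> realizes l' V2 p y [:: b; a] ->
    good_chain (l1 ++ l2) (V1 :|: V2) x y.
  move=> E2 dp dy b0 a0 ab /(close2 py); rewrite -E2 => r.
  apply: (@GoodGeneric _ _ _ _ a (a - b)).
  - by rewrite ldr E2 ldeg_close.
  - by rewrite subr_eq0.
  - by [].
  - by rewrite -subr_eq0 opprB addrC subrK.
  apply: (series_realizes n1 n2 V12 (tau := 2) r1 r) => //.
    by rewrite dp1E E2 ldeg_close.
  by case=> [|[|//]] _; rewrite /= ?mul1r // mulN1r opprB.
case: B => [[_ E2 EV2|l' E2 C]|C].
- apply: path_ext; rewrite E2 EV2; last exact: realizes_edge.
  by rewrite cards2 py.
- case: (C) => _ dp dy.
  case=> [d k d2 dd k0 r|a b dl b0 r|a b dr b0 a0 ab r|b c dr b0 r c0 r'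
         |a b c k dl dr a0 r b0 r'|c sV r c0 r'].
  + exact: (closed_pure l' d k).
  + case: (eqVneq a 0) => [a0|a0].
      by apply: (closed_pure l' 1 b) => //; rewrite -a0.
    have := close2 py r; rewrite -E2 => r2.
    by apply: (const _ 2 _ r2) => //; rewrite E2 ldeg_close.
  + exact: closedE r.
  + by apply: (closed_equal l' b E2 C) => //; right; exists c.
  + have := close2 py r; rewrite -E2 => r2.
    by apply: (const _ 2 _ r2) => //; rewrite E2 ldeg_close.
  + case: (eqVneq (1 : int) ((-1) ^+ size l')) => [s1E|sN1].
      by rewrite -s1E in r; apply: (closed_equal l' 1 E2 C) => //; right; exists c.
    by apply: closedE r; rewrite // signr_eq0.
case: (C) => _ dp dy.
case=> [d k d2 dd k0 r|a b dl b0 r|a b dr b0 a0 ab r|b c dr b0 r c0 r'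
       |a b c k dl dr a0 r b0 r'|c sV r c0 r'].
- exact: chain_pure r.
- by apply: chain_left r => //; left.
(* Prefixing an edge negates the coefficient of [y], so equal coefficients arise when [a = - b]. *)
- case: (eqVneq a (- b)) => [aE|aN].
    apply: (@GoodEqual _ _ _ _ a b); rewrite ?ldr //; last exact: xyE r.
    by rewrite {1}aE; apply: linE.
  by apply: (@GoodGeneric _ _ _ _ a (- b)); rewrite ?ldr ?oppr_eq0 //; apply: linE.
- apply: (@GoodGeneric _ _ _ _ b (- b)); rewrite ?ldr ?oppr_eq0 //; last exact: linE.
  by apply: contra b0 => /eqP bb; apply/eqP; move: bb; clear; lia.
- by apply: chain_left r => //; right.
- exact: path_ext r.
Qed.
End Chains.

(** * Coefficients of the graph polynomial and Eulerian subdigraphs *)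

Section AlonTarsiCoefficient.
Local Open Scope ring_scope.
Variable T : finType.
Implicit Types (t : {ffun T -> nat}) (l L : seq (T * T)) (H : {set T * T}).

(** Follow a nonzero branch of the recursion and orient each edge out of the end it picks; reversing
    a factor only changes the sign. *)
Lemma gcoef_orient l t : gcoef l t != 0 -> exists L (s : bool),
  [/\ forall x y, (count_mem (x, y) L + count_mem (y, x) L =
                   count_mem (x, y) l + count_mem (y, x) l)%N,
      forall v, count (fun a => a.1 == v) L = t v &
      forall t', gcoef L t' = (-1) ^+ s * gcoef l t'].
Proof.
elim: l t => [|[u v] l IH] t.
  rewrite /=; case: (t =P _) => [-> _|_]; last by rewrite eqxx.
  by exists [::], false; split=> // w; rewrite ?ffunE ?mul1r.
have key p q (b : bool) : (p, q) = (if b then (v, u) else (u, v)) -> (0 < t p)%N ->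
    gcoef l (lower p t) != 0 -> exists L (s : bool),
    [/\ forall x y, (count_mem (x, y) L + count_mem (y, x) L =
           count_mem (x, y) ((u, v) :: l) + count_mem (y, x) ((u, v) :: l))%N,
        forall w, count (fun a => a.1 == w) L = t w &
        forall t', gcoef L t' = (-1) ^+ s * gcoef ((u, v) :: l) t'].
  move=> E tp /IH[L [s [c o g]]]; exists ((p, q) :: L), (b (+) s); split=> [x y|w|t'].
  - rewrite /= [LHS]addnACA c [RHS]addnACA; congr (_ + _)%N.
    case: b E => -[-> ->] //; rewrite addnC !xpair_eqE.
    by rewrite [(v == y) && _]andbC [(v == x) && _]andbC.
  - rewrite /= o ffunE [w == p]eq_sym; case: eqP => [<-|_]; last by rewrite subn0.
    by rewrite subnKC.
  - rewrite signr_addb /= !g.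
    by case: b E => -[-> ->]; do 2 case: ifP => _; rewrite /= ?expr0 ?expr1; ring.
rewrite /=; case: (ltnP 0%N (t u)) => tu; last first.
  rewrite sub0r oppr_eq0; case: ltnP => // tv h.
  exact: (key v u true).
have [h|h] := eqVneq (gcoef l (lower u t)) 0; last by move=> _; apply: (key u v false).
rewrite h sub0r oppr_eq0; case: ltnP => // tv h'.
exact: (key v u true).
Qed.

Lemma outdegU1 a H v : a \notin H -> outdeg (a |: H) v = ((v == a.1) + outdeg H v)%N.
Proof.
move=> aH; rewrite /outdeg -!sum1dep_card !big_mkcondr /= big_setU1 //= eq_sym.
by case: eqP.
Qed.

Lemma indegU1 a H v : a \notin H -> indeg (a |: H) v = ((v == a.2) + indeg H v)%N.
Proof.
move=> aH; rewrite /indeg -!sum1dep_card !big_mkcondr /= big_setU1 //= eq_sym.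
by case: eqP.
Qed.

Lemma outdeg_seq L v : uniq L -> outdeg [set a in L] v = count (fun a => a.1 == v) L.
Proof.
move=> uL; rewrite -size_filter -(card_uniqP (filter_uniq _ uL)).
by apply: eq_card => a; rewrite !inE mem_filter andbC.
Qed.

Lemma outdegS H H' v : H \subset H' -> (outdeg H v <= outdeg H' v)%N.
Proof.
move=> /subsetP sH; apply/subset_leq_card/subsetP => a.
by rewrite !inE => /andP[/sH -> ->].
Qed.

(** This expands the product: [H] collects the arcs that contribute their head, each with a minus
    sign. The equation at [v] compares exponents, arranged to avoid subtraction. *)
Lemma gcoef_sum L t : uniq L ->
  gcoef L t = \sum_(H : {set T * T} | H \subset [set a in L])
    (-1) ^+ #|H| * [forall v, (count (fun a => a.1 == v) L + indeg H v ==
                               t v + outdeg H v)%N]%:R.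
Proof.
elim: L t => [|a L IH] t /= => [_|/andP[aL uL]].
  rewrite (big_pred1 set0) => [|H]; last first.
    by rewrite /= -subset0; congr (_ \subset _); apply/setP => b; rewrite !inE.
  rewrite cards0 mul1r; congr (nat_of_bool _)%:R.
  have io v : (outdeg set0 v = 0)%N /\ (indeg (set0 : {set T * T}) v = 0)%N.
    by split; apply/eqP; rewrite cards_eq0; apply/eqP/setP => b; rewrite !inE.
  apply/eqP/forallP => [-> v|t0].
    by have [-> ->] := io v; rewrite ffunE.
  by apply/ffunP => v; have [o i] := io v; have := t0 v; rewrite ffunE o i !addn0 => /eqP <-.
have key w : \sum_(H : {set T * T} | H \subset [set b in L]) (-1) ^+ #|H| *
    [forall v, ((v == w) + count (fun b => b.1 == v) L + indeg H v == t v + outdeg H v)%N]%:R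
   = if (0 < t w)%N then gcoef L (lower w t) else 0 :> int.
  case: ltnP => [tw|]; last first.
    (* The exponent of [w] would be at least 1, since [H] takes away at most the arcs leaving
       [w]. *)
    rewrite leqn0 => /eqP tw; apply: big1 => H sH.
    case: forallP => [/(_ w)|_]; rewrite ?mulr0 // eqxx tw => h.
    by have := outdegS w sH; rewrite outdeg_seq //; lia.
  rewrite IH //; apply: eq_bigr => H _; congr (_ * (nat_of_bool _)%:R).
  apply: eq_forallb => v; rewrite ffunE.
  by case: (v =P w) => [->|_]; lia.
have aS : a \notin [set b in L] by rewrite inE.
have SE : [set b in a :: L] = a |: [set b in L].
  by apply/setP => b; rewrite !inE.
rewrite SE (bigID (fun H => a \notin H)) /=; congr (_ + _).
  rewrite -key; apply/esym; apply: eq_big => [H|H _].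
    apply/andP/idP => [[sH aH]|sH].
      apply/subsetP => b bH; have /setU1P[ba|//] := subsetP sH b bH.
      by rewrite -ba bH in aH.
    split; first exact: subset_trans sH (subsetUr _ _).
    by apply: contra aS => /(subsetP sH).
  by congr (_ * (nat_of_bool _)%:R); apply: eq_forallb => v; rewrite [a.1 == v]eq_sym.
rewrite -key -sumrN; apply/esym.
rewrite (reindex_onto (fun H => a |: H) (fun H => H :\ a)) /=; last first.
  by move=> H /andP[_ /negPn aH]; rewrite setD1K.
apply: eq_big => [H|H].
  rewrite negbK setU11 andbT; apply/andP/idP => [[sH /eqP HE]|sH].
    have aH : a \notin H by rewrite -HE !inE eqxx.
    apply/subsetP => b bH; have /setU1P[ba|//] := subsetP sH b (setU1r a bH).
    by rewrite -ba bH in aH.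
  have aH : a \notin H by apply: contra aS => /(subsetP sH).
  by rewrite setUS // setU1K.
case/andP=> _ /eqP HE; have aH : a \notin H by rewrite -HE !inE eqxx.
rewrite cardsU1 aH exprS mulN1r mulNr; congr (- (_ * (nat_of_bool _)%:R)).
apply: eq_forallb => v; rewrite outdegU1 // indegU1 //.
by rewrite [a.1 == v]eq_sym; lia.
Qed.

(** When [t] is the outdegree sequence, the sets [H] of the expansion are the Eulerian ones, so up
    to sign the coefficient is the difference between the even and the odd count. *)
Lemma gcoef_AT (e : rel T) l t :
  (forall x y, (count_mem (x, y) l + count_mem (y, x) l = e x y)%N) ->
  gcoef l t != 0 ->
  exists D, AT_orientation e D /\ forall v, outdeg D v = t v.
Proof.
move=> lE lt; have [L [s [c o g]]] := gcoef_orient lt.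
have {}c x y : (count_mem (x, y) L + count_mem (y, x) L = e x y)%N by rewrite c.
have uL : uniq L.
  apply: count_mem_uniq => -[x y]; have := c x y; rewrite -has_pred1 has_count.
  by case: (count_mem (x, y) L) => [|[|n]]; case: (e x y) => //; lia.
have mL x y : ((x, y) \in L) = (0 < count_mem (x, y) L)%N by rewrite -has_pred1 has_count.
exists [set a in L]; split; last by move=> v; rewrite outdeg_seq.
split; first split=> x y.
- by rewrite inE mL; have := c x y; case: (e x y) => //; lia.
- by move=> exy; rewrite !inE !mL; have := c x y; rewrite exy; lia.
move=> eo; move/eqP: lt; apply; have := g t.
suff -> : gcoef L t = 0 by move/esym/eqP; rewrite mulf_eq0 signr_eq0 => /eqP.
rewrite gcoef_sum //.
have -> : \sum_(H : {set T * T} | H \subset [set a in L])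
    (-1) ^+ #|H| * [forall v, (count (fun a => a.1 == v) L + indeg H v ==
                               t v + outdeg H v)%N]%:R
  = \sum_(H : {set T * T} | H \in even_eulerian [set a in L]) 1
    - \sum_(H : {set T * T} | H \in odd_eulerian [set a in L]) 1 :> int.
  rewrite -sumrN !(big_mkcond (fun H => H \in _)) -big_split /= big_mkcond.
  apply: eq_bigr => H _; rewrite !inE.
  have -> : [forall v, (count (fun a => a.1 == v) L + indeg H v == t v + outdeg H v)%N]
          = eulerian H.
    by apply: eq_forallb => v; rewrite o eqn_add2l eq_sym.
  case: (_ \subset _) => //=; case: (eulerian H) => /=; last by rewrite mulr0.
  by rewrite mulr1 -signr_odd; case: (odd _).
by rewrite !sumr_const eo subrr.
Qed.

End AlonTarsiCoefficient.

(** * Admissible monomials of a closed network *)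

Section ClosedChain.
Local Open Scope ring_scope.
Variable T : finType.
Implicit Types (l : seq (T * T)) (V : {set T}).

Lemma realizes_coef l V x y al i : network l V x y -> realizes l V x y al ->
  (i < size al)%N -> al`_i != 0 ->
  (i < minn 5 (ldeg l x))%N -> ((size al).-1 - i < minn 5 (ldeg l y))%N ->
  exists t, gcoef l t != 0 /\ forall v, v \in V -> (t v < minn 5 (ldeg l v))%N.
Proof.
case=> [xy _ _ _] [t [tV tb _ _ tc]] ia ai ix iy.
have yx : y != x by rewrite eq_sym.
exists (place t x i y ((size al).-1 - i)); rewrite tc //; split=> // v vV.
rewrite ffunE; have [->|vx] := eqVneq v x.
  by rewrite tV ?eqxx ?orbT // (negbTE xy) mul1n mul0n addn0.
have [->|vy] := eqVneq v y; first by rewrite tV ?eqxx ?orbT // mul1n.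
by rewrite !mul0n !addn0 tb.
Qed.

(** Closing a linear form gives [x y] the coefficient [b - a]. If it cancels in [GoodLeft] or
    [GoodEqual], the square of the terminal with at least two edges in [l] takes over; a path of
    even length is left as the odd cycle. *)
Lemma closed_chain_coef l V x y : chain l V x y ->
  (#|V| = (size l).+1 /\ ~~ odd (size l)) \/
  exists t, gcoef ((x, y) :: l) t != 0 /\
    forall v, v \in V -> (t v < minn 5 (ldeg ((x, y) :: l) v))%N.
Proof.
move=> C; case: (C) => -[xy xV yV eV] dx dy g.
have n : network ((x, y) :: l) V x y by split=> //; rewrite /ends_in /= xV yV.
have [dxE dyE] := ldeg_close l xy.
have two a b : b != a -> realizes l V x y [:: b; a] -> exists t,
    gcoef ((x, y) :: l) t != 0 /\
    forall v, v \in V -> (t v < minn 5 (ldeg ((x, y) :: l) v))%N.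
  move=> ba /(close2 xy) r; apply: (realizes_coef n r (i := 1)) => //.
  - by rewrite /= subr_eq0.
  - by rewrite dxE leq_min.
  - by rewrite dyE leq_min.
case: g => [d k d2 dd k0 r|a b dl b0 r|a b dr b0 a0 ab r|b c dr b0 r _ _
           |a b c k dl dr a0 r _ _|c sV r _ _].
- right; apply: (realizes_coef n (close_pure xy r) (i := 1)) => //.
  + by rewrite dxE leq_min.
  + by rewrite /= size_nseq subn1 /= dyE leq_min !ltnS dd andbT (leq_trans d2).
- right; case: (eqVneq b a) => [ba|ba]; last exact: two r.
  have r2 := close2 xy r; rewrite -ba in r2.
  apply: (realizes_coef n r2 (i := 2)) => //.
  + by rewrite dxE leq_min.
  + by rewrite dyE leq_min.
- by right; apply: two r; rewrite eq_sym.
- right; apply: (realizes_coef n (close2 xy r) (i := 0)) => //.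
  + by rewrite /= oppr_eq0.
  + by rewrite dxE leq_min.
  + by rewrite dyE leq_min.
- by right; apply: two r; rewrite eq_sym.
case: (boolP (odd (size l))) => o; last by left.
by right; apply: two r; rewrite -signr_odd o.
Qed.

End ClosedChain.

(** * Cutting a noncrossing graph with a Hamiltonian cycle into blocks *)

Section NonCrossing.
Variables (T : finType) (e : rel T) (idx : T -> nat).
Hypotheses (e_sym : symmetric e) (e_irr : irreflexive e).
Hypothesis idx_inj : injective idx.
Hypothesis idx_lt : forall v, idx v < #|T|.
Hypothesis card_gt2 : 2 < #|T|.
Hypothesis idx_next : forall x y, idx y = (idx x).+1 %% #|T| -> e x y.
Hypothesis noncrossing : forall x y z t,
  idx x < idx z -> idx z < idx y -> idx y < idx t -> e x y -> e z t -> False.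

Implicit Types (l : seq (T * T)).

Definition span x y : {set T} := [set v | idx x <= idx v <= idx y].

Lemma idx_surj k : k < #|T| -> exists v, idx v = k.
Proof.
move=> kn; pose io v := Ordinal (idx_lt v).
have /inj_card_bij : injective io by move=> u v [/idx_inj].
rewrite card_ord => /(_ (leqnn _)) [g _ gK].
by exists (g (Ordinal kn)); have /(congr1 val) := gK (Ordinal kn).
Qed.

Definition edge_count l (u v : T) : nat := count_mem (u, v) l + count_mem (v, u) l.

Lemma edge_countC l u v : edge_count l u v = edge_count l v u.
Proof. exact: addnC. Qed.

(** Let [p] be the furthest neighbour of [x] strictly before [y]. No edge other than [xy] passes
    over [p], so the interval is the piece from [x] to [p] in series with the block from [p] to [y];
    [m] bounds the length for the induction. *)
Lemma decompose_block m x y : idx y - idx x <= m -> idx x < idx y ->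
  (exists l, [/\ block l (span x y) x y, e x y -> piece l (span x y) x y &
     forall u v, edge_count l u v = [&& e u v, u \in span x y & v \in span x y]]) /\
  ((idx x).+1 < idx y -> exists l, chain l (span x y) x y /\
     forall u v, edge_count l u v =
       [&& e u v, u \in span x y, v \in span x y &
           ~~ ((u == x) && (v == y) || (u == y) && (v == x))]).
Proof.
elim: m x y => [|m IH] x y hm xy; first by lia.
have xNy : x != y by apply: contraTneq xy => ->; rewrite ltnn.
have [sx sy] : x \in span x y /\ y \in span x y by rewrite !inE !leqnn !(ltnW xy).
have ch : (idx x).+1 < idx y -> exists l, chain l (span x y) x y /\
     forall u v, edge_count l u v =
       [&& e u v, u \in span x y, v \in span x y &
           ~~ ((u == x) && (v == y) || (u == y) && (v == x))].
  (* The successor of [x] shows that there is a candidate for [p]. *)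
  move=> x1y; have [z zx] := idx_surj (leq_ltn_trans (ltnW x1y) (idx_lt y)).
  have exz : e x z.
    by apply: idx_next; rewrite modn_small // -zx.
  pose P := [pred v | e x v && (idx x < idx v < idx y)].
  have Pz : P z by rewrite /= exz zx ltnSn.
  case: (@arg_maxnP _ z P idx Pz) => p /and3P[exp xp py] pmax.
  have [[l1 [_ /(_ exp) P1 c1]] _] : _ := IH x p ltac:(lia) xp.
  have [[l2 [B2 _ c2]] _] : _ := IH p y ltac:(lia) py.
  have VI : span x p :&: span p y = [set p].
    apply/setP => v; rewrite !inE; apply/idP/eqP => [h|->].
      by apply: idx_inj; lia.
    by rewrite !leqnn (ltnW xp) (ltnW py).
  have VU : span x p :|: span p y = span x y.
    by apply/setP => v; rewrite !inE; lia.
  exists (l1 ++ l2); split; first by rewrite -VU; apply: piece_series P1 B2 VI.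
  have half u v : idx u <= idx v -> edge_count (l1 ++ l2) u v =
       [&& e u v, u \in span x y, v \in span x y &
           ~~ ((u == x) && (v == y) || (u == y) && (v == x))].
    move=> uv; rewrite /edge_count !count_cat addnACA -!/(edge_count _ _ _) c1 c2.
    case: (boolP (e u v)) => //= euv.
    have uNv : idx u != idx v.
      by apply: contraTneq euv => /idx_inj ->; rewrite e_irr.
    have -> : (u == y) && (v == x) = false.
      by apply/negP => /andP[/eqP uy /eqP vx]; rewrite uy vx in uv; lia.
    rewrite orbF; case: (boolP ((u == x) && (v == y))) => [/andP[/eqP -> /eqP ->]|N].
      by rewrite !inE; lia.
    rewrite andbT !inE.
    have [vp|vp] := leqP (idx v) (idx p); first by lia.
    have [pu|up] := leqP (idx p) (idx u); first by lia.
    (* An edge over [p] either starts at [x], against the choice of [p], or crosses the edge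
       [xp]. *)
    suff : ~ (idx x <= idx u /\ idx v <= idx y) by lia.
    case=> xu vy; case: (eqVneq u x) => [ux|ux].
      have vNy : v != y by move: N; rewrite ux eqxx.
      have : idx v != idx y by rewrite inj_eq.
      move=> vy'; have /pmax : P v by rewrite /= -{1}ux euv; lia.
      by rewrite /=; lia.
    have xu' : idx x < idx u by rewrite ltn_neqAle xu inj_eq // eq_sym ux.
    exact: (noncrossing xu' up vp exp euv).
  move=> u v; have [/half//|/ltnW/half h] := leqP (idx u) (idx v).
  rewrite edge_countC h [e v u]e_sym; case: (e u v) => //=.
  rewrite andbCA orbC; congr (nat_of_bool [&& _, _ & ~~ (_ || _)]); exact: andbC.
split=> //.
have [x1y|y1] := ltnP (idx x).+1 (idx y).
  have [l [C c]] := ch x1y; have [exy|nexy] := boolP (e x y).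
    have P := PieceClosed (erefl ((x, y) :: l)) C.
    exists ((x, y) :: l); split=> //; first by left.
    move=> u v; rewrite /edge_count /= addnACA -/(edge_count _ _ _) c !xpair_eqE.
    rewrite [x == u]eq_sym [y == v]eq_sym [x == v]eq_sym [y == u]eq_sym [(v == x) && _]andbC.
    have [/andP[/eqP -> /eqP ->]|_] := boolP ((u == x) && (v == y)).
      by rewrite exy sx sy (negbTE xNy).
    have [/andP[/eqP -> /eqP ->]|_] := boolP ((u == y) && (v == x)).
      by rewrite e_sym exy sx sy.
    by rewrite andbT.
  exists l; split=> [||u v]; [by right|by []|].
  rewrite c; case: (boolP (e u v)) => //= euv.
  suff -> : ~~ ((u == x) && (v == y) || (u == y) && (v == x)) by rewrite andbT.
  apply: contra nexy => /orP[] /andP[/eqP <- /eqP <-] //.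
  by rewrite e_sym.
have yE : idx y = (idx x).+1 by lia.
have exy : e x y by apply: idx_next; rewrite modn_small // -yE.
have sE : span x y = [set x; y].
  apply/setP => v; rewrite !inE -!(inj_eq idx_inj); lia.
have P : piece [:: (x, y)] (span x y) x y by rewrite sE; apply: PieceEdge.
exists [:: (x, y)]; split=> [||u v]; [by left|by []|].
rewrite /edge_count /= sE !inE !xpair_eqE.
rewrite [x == u]eq_sym [y == v]eq_sym [x == v]eq_sym [y == u]eq_sym.
rewrite [(v == x) && _]andbC.
have [/andP[/eqP -> /eqP ->]|N1] := boolP ((u == x) && (v == y)).
  by rewrite exy !eqxx (negbTE xNy) orbT.
have [/andP[/eqP -> /eqP ->]|N2] := boolP ((u == y) && (v == x)).
  by rewrite e_sym exy !eqxx orbT.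
apply/esym/eqP; rewrite eqb0; apply/negP => /and3P[euv /orP[] /eqP uE /orP[] /eqP vE];
  move: euv N1 N2; rewrite uE vE ?e_irr ?eqxx //.
Qed.

Lemma ldeg_edge_count l v :
  (forall x y, edge_count l x y = e x y) -> ldeg l v = deg e v.
Proof.
move=> lE; rewrite /deg -sum1dep_card big_mkcond /=.
have fstE : count (fun a => a.1 == v) l = \sum_u count_mem (v, u) l.
  elim: {lE} l => [|[a b] l IH] /=; first by rewrite big1.
  rewrite big_split /= -IH (bigD1 b) //= big1 ?addn0 => [|u ub].
    by rewrite xpair_eqE eqxx andbT.
  by rewrite xpair_eqE eq_sym [b == u]eq_sym (negbTE ub) andbF.
have sndE : count (fun a => a.2 == v) l = \sum_u count_mem (u, v) l.
  elim: {lE fstE} l => [|[a b] l IH] /=; first by rewrite big1.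
  rewrite big_split /= -IH (bigD1 a) //= big1 ?addn0 => [|u ua].
    by rewrite xpair_eqE eqxx.
  by rewrite xpair_eqE [a == u]eq_sym (negbTE ua).
rewrite /ldeg fstE sndE -big_split /=; apply: eq_bigr => u _.
by move: (lE v u); rewrite /edge_count => ->; case: (e v u).
Qed.

Lemma sum_ldeg l : \sum_v ldeg l v = (size l).*2.
Proof.
elim: l => [|[a b] l IH]; first by rewrite big1.
rewrite (eq_bigr (fun v => (a == v) + (b == v) + ldeg l v)) => [|v _]; last first.
  by rewrite /ldeg /= addnACA.
rewrite big_split big_split /= IH (bigD1 a) //= big1 => [|v /negbTE]; last by rewrite eq_sym => ->.
rewrite (bigD1 b) //= big1 => [|v /negbTE]; last by rewrite eq_sym => ->.
by rewrite !eqxx doubleS.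
Qed.

Lemma two_regular_cycle : (forall v, deg e v = 2) -> is_cycle_graph e #|T|.
Proof.
move=> deg2; split=> //.
pose io v := Ordinal (idx_lt v).
have io_inj : injective io by move=> u v [/idx_inj].
have := inj_card_bij io_inj; rewrite card_ord => /(_ (leqnn _)) [g gK ioK].
exists g; split; first by exists io.
move=> i j; have io_next u v : io v = ordS (io u) -> e u v.
  by move=> /(congr1 val) /= h; apply: idx_next.
have nx : e (g i) (g (ordS i)) by apply: io_next; rewrite !ioK.
have px : e (g i) (g (ord_pred i)).
  by rewrite e_sym; apply: io_next; rewrite !ioK ord_predK.
have ne : g (ordS i) != g (ord_pred i).
  rewrite (inj_eq (can_inj ioK)) -(inj_eq (@ordS_inj _)) ord_predK.
  apply/eqP => /(congr1 val) /=; have := ltn_ord i.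
  move: card_gt2; set n := #|T|; move: (val i) => k n2 kn.
  have [k1|k1] := ltnP k.+1 n.
    rewrite (modn_small k1); have [k2|k2] := ltnP k.+2 n; first by rewrite modn_small //; lia.
    have -> : k.+2 = n by lia.
    by rewrite modnn; lia.
  have -> : k.+1 = n by lia.
  by rewrite modnn modn_small; lia.
have NE : [set u | e (g i) u] = [set g (ordS i); g (ord_pred i)].
  apply/eqP; rewrite eq_sym eqEcard cards2 ne -/(deg e (g i)) deg2 leqnn andbT.
  by apply/subsetP => u; rewrite !inE => /orP[] /eqP ->.
have -> : e (g i) (g j) = (g j \in [set u | e (g i) u]) by rewrite inE.
rewrite NE !inE !(inj_eq (can_inj ioK)) [j == ordS i]eq_sym; congr (_ || _).
by rewrite -[j == _](inj_eq (@ordS_inj _)) ord_predK.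
Qed.

(** In the exceptional case there are as many edges as vertices, while the cyclic order makes every
    degree at least 2; hence all degrees are 2 and the graph is an odd cycle. *)
Lemma noncrossing_AT : ~ is_odd_cycle e -> truncated_degree_AT 5 e.
Proof.
move=> notodd.
have n0 : 0 < #|T| by lia.
have [x x0] := idx_surj n0.
have [y yE] : exists y, idx y = #|T|.-1 by apply: idx_surj; rewrite prednK.
have exy : e x y.
  by rewrite e_sym; apply: idx_next; rewrite x0 yE prednK // modnn.
have xNy : x != y by apply: contraTneq exy => ->; rewrite e_irr.
have VT : span x y = setT.
  by apply/setP => v; rewrite !inE x0 yE /= -ltnS prednK // idx_lt.
have [_ [|l [C c]]] := @decompose_block _ x y (leqnn _) ltac:(lia); first by lia.
rewrite VT in C c.
have cE u v : edge_count ((x, y) :: l) u v = e u v.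
  rewrite /edge_count /= addnACA -/(edge_count _ _ _) c !xpair_eqE !inE /=.
  rewrite [x == u]eq_sym [y == v]eq_sym [x == v]eq_sym [y == u]eq_sym [(v == x) && _]andbC.
  have [/andP[/eqP -> /eqP ->]|_] := boolP ((u == x) && (v == y)).
    by rewrite exy (negbTE xNy).
  have [/andP[/eqP -> /eqP ->]|_] := boolP ((u == y) && (v == x)).
    by rewrite e_sym exy.
  by rewrite andbT.
case: (closed_chain_coef C) => [[VE evl]|[t [gt tb]]].
  case: notodd; exists #|T|; rewrite cardsT in VE; split; first by rewrite VE.
  apply: two_regular_cycle.
  have deg_ge2 v : 2 <= deg e v.
    have [u uE] := idx_surj (ltn_pmod (idx v).+1 n0).
    have [w wE] : exists w, idx v = (idx w).+1 %% #|T|.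
      have [v0|v0] := posnP (idx v).
        by exists y; rewrite yE prednK // modnn.
      have vlt := idx_lt v; have [w wE] := @idx_surj (idx v).-1 ltac:(lia).
      by exists w; rewrite wE prednK // modn_small.
    (* Otherwise a shift by 2 modulo [#|T|] would fix [idx v]. *)
    have uw : u != w.
      apply/eqP => uw; move: wE; rewrite -uw uE -addn1 modnDml addn1.
      have := idx_lt v; move: card_gt2; set n := #|T|; move: (idx v) => k n2 kn.
      have [k2|k2] := ltnP k.+2 n; first by rewrite modn_small //; lia.
      have [k3|k3] := ltnP k.+1 n.
        have -> : k.+2 = n by lia.
        by rewrite modnn; lia.
      have -> : k.+2 = n + 1 by lia.
      by rewrite modnDl modn_small; lia.
    have <- : #|[set u; w]| = 2 by rewrite cards2 uw.
    apply/subset_leq_card/subsetP => z; rewrite !inE => /orP[] /eqP ->.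
      exact: idx_next.
    by rewrite e_sym; apply: idx_next.
  have sumE : \sum_v deg e v = \sum_(v : T) 2.
    rewrite -(eq_bigr _ (fun v _ => ldeg_edge_count v cE)) sum_ldeg /=.
    by rewrite sum_nat_const VE muln2.
  move=> v; apply/eqP; rewrite eqn_leq deg_ge2 andbT leqNgt; apply/negP => v3.
  move: sumE; rewrite (bigD1 v) // [RHS](bigD1 v) //=.
  have : \sum_(u | u != v) 2 <= \sum_(u | u != v) deg e u by apply: leq_sum.
  by lia.
have [D [atD oD]] := gcoef_AT cE gt.
exists D; split=> // v; rewrite oD -(ldeg_edge_count v cE); apply: tb.
by rewrite inE.
Qed.

End NonCrossing.

(** * The cycle space modulo 2 of a spherical rotation system *)

Section Potential.
Variables (T : finType) (e : rel T) (rho : T -> {perm T}).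
Hypotheses (e_sym : symmetric e) (e_irr : irreflexive e).
Hypothesis e_conn : forall x y, connect e x y.
Hypothesis rot : rotation_system e rho.
Hypothesis euler : #|T| + #|faces e rho| = #|edges e| + 2.

Lemma rho_nbr v u : e v u -> e v (rho v u).
Proof. by move=> vu; rewrite -(expg1 (rho v)) (rot _ vu) mem_porbit. Qed.

Lemma nbr_rho v u : e v (rho v u) -> e v u.
Proof. by move=> vu; rewrite (rot _ vu) porbit_sym -{1}(expg1 (rho v)) mem_porbit. Qed.

Lemma face_step_inj : injective (face_step rho).
Proof. by move=> [u v] [u' v'] [<- /perm_inj ->]. Qed.

Lemma face_of_step a : face_of rho (face_step rho a) = face_of rho a.
Proof.
by apply/setP => b; rewrite !inE -(same_fconnect1 face_step_inj).
Qed.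

Lemma sum_edge_darts (R : nmodType) (g : T * T -> R) u v : e u v ->
  (\sum_(a in darts e | [set a.1; a.2] == [set u; v]) g a = g (u, v) + g (v, u))%R.
Proof.
move=> uv; have uNv : u != v by apply: contraTneq uv => ->; rewrite e_irr.
rewrite (bigD1 (u, v)) /=; last by rewrite inE uv eqxx.
congr (_ + _)%R; rewrite (big_pred1 (v, u)) // => -[a b] /=.
rewrite inE /= !xpair_eqE; apply/idP/idP.
  case/andP=> /andP[ab /eqP abE] N.
  have : a \in [set u; v] by rewrite -abE !inE eqxx.
  have : b \in [set u; v] by rewrite -abE !inE eqxx orbT.
  rewrite !inE => /orP[] /eqP bE /orP[] /eqP aE; move: ab N; rewrite aE bE ?e_irr ?eqxx //.
case/andP=> /eqP -> /eqP ->; rewrite e_sym uv setUC eqxx /=.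
by rewrite eq_sym (negbTE uNv).
Qed.

Lemma sum_vertex_edges (R : nmodType) (G : {set T} -> R) v :
  (\sum_(E in edges e | v \in E) G E = \sum_(u | e v u) G [set v; u])%R.
Proof.
have inj : {in [set u | e v u] &, injective (fun u => [set v; u])}.
  move=> u w; rewrite !inE => vu vw h.
  have : u \in [set v; w] by rewrite -h !inE eqxx orbT.
  by rewrite !inE => /orP[] /eqP // uv; rewrite uv e_irr in vu.
transitivity (\sum_(u in [set u | e v u]) G [set v; u])%R; last first.
  by apply: eq_bigl => u; rewrite inE.
rewrite -(big_imset _ inj); apply: eq_bigl => E /=.
apply/andP/imsetP => [[/imsetP[[a b]]]|[u]]; rewrite !inE => ab -> /=; rewrite !inE.
  case/orP => /eqP ->; first by exists b; rewrite ?inE.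
  by exists a; rewrite ?inE 1?e_sym // setUC.
rewrite eqxx; split=> //.
by apply/imsetP; exists (v, u); rewrite ?inE.
Qed.


Lemma face_step_dart a : e a.1 a.2 -> e (face_step rho a).1 (face_step rho a).2.
Proof. by move=> ea; apply: rho_nbr; rewrite e_sym. Qed.

Local Notation K := 'F_2.
Local Open Scope ring_scope.

Lemma F2_bool (x : K) : x = (x != 0)%:R.
Proof. by case: x => -[|[|//]] i; apply/val_inj. Qed.

Lemma F2_addE (x y : K) : (x + y != 0) = (x != 0) (+) (y != 0).
Proof. by case: x y => -[|[|//]] i [[|[|//]] j]. Qed.

Lemma F2_add_eq0 (x y : K) : x + y = 0 -> x = y.
Proof.
move=> xy; have := F2_addE x y; rewrite xy eqxx => h.
by rewrite (F2_bool x) (F2_bool y); case: (x != 0) (y != 0) h => -[].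
Qed.

Lemma constant_ker_rank m n (A : 'M[K]_(m, n)) :
  (forall u : 'rV_m, u *m A = 0 -> exists c, u = const_mx c) ->
  (m.-1 <= \rank A)%N.
Proof.
move=> ker; suff : (m - \rank A <= 1)%N by lia.
rewrite -mxrank_ker; apply: leq_trans (rank_leq_row (const_mx 1 : 'rV[K]_m)).
apply/mxrankS/row_subP => i.
have [|c ->] := ker (row i (kermx A)); first by rewrite -row_mul mulmx_ker row0.
by rewrite (_ : const_mx c = c *: const_mx 1) ?scalemx_sub // scalemx_const mulr1.
Qed.

Definition incidence : 'M[K]_(#|edges e|, #|T|) :=
  \matrix_(i, j) ((enum_val j : T) \in (enum_val i : {set T}))%:R.

(** The sum runs over both darts of an edge, so an edge with the same face on both sides counts 0
    modulo 2. *)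
Definition boundary : 'M[K]_(#|faces e rho|, #|edges e|) :=
  \matrix_(f, i) \sum_(a in darts e | [set a.1; a.2] == enum_val i)
    (face_of rho a == enum_val f)%:R.

Lemma edge_index u v : e u v -> exists i : 'I_#|edges e|, enum_val i = [set u; v].
Proof.
move=> uv; have E : [set u; v] \in edges e by apply/imsetP; exists (u, v); rewrite ?inE.
by exists (enum_rank_in E [set u; v]); rewrite enum_rankK_in.
Qed.

Lemma connected_const (R : Type) (w : T -> R) :
  (forall u v, e u v -> w u = w v) -> forall u v, w u = w v.
Proof.
move=> we u v; have /connectP[p] := e_conn u v.
elim: p u => [|z p IH] u /=; first by move=> _ ->.
by case/andP=> /we -> /IH h /h.
Qed.

(** A vertex vector killed by the transpose agrees at the ends of every edge, hence is constant by
    connectedness. *)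
Lemma rank_incidence : (#|T|.-1 <= \rank incidence)%N.
Proof.
rewrite -mxrank_tr; apply: constant_ker_rank => u u0.
pose w x := u 0 (enum_rank x).
have wE a b : e a b -> w a = w b.
  move=> ab; apply: F2_add_eq0; have [i iE] := edge_index ab.
  have := congr1 (fun M : 'rV__ => M 0 i) u0; rewrite !mxE => <-.
  rewrite (eq_bigr (fun j => (fun x => w x * (x \in [set a; b])%:R) (enum_val j))).
    rewrite -(big_enum_val (fun x => w x * (x \in [set a; b])%:R)) /=.
    rewrite (bigD1 a) //= (bigD1 b) /=; last first.
      by apply: contraTneq ab => ->; rewrite e_irr.
    rewrite big1 => [|x /andP[/negbTE xa /negbTE xb]]; last by rewrite !inE xa xb mulr0.
    by rewrite !inE !eqxx orbT !mulr1 addr0.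
  by move=> j _; rewrite !mxE /w enum_valK iE.
have [|T0] := posnP #|T|.
  by move=> T0; exists 0; apply/rowP => j; have := leq_trans (ltn_ord j) (eq_leq T0).
exists (u 0 (Ordinal T0)); apply/rowP => j; rewrite [RHS]mxE.
by have := connected_const wE (enum_val j) (enum_val (Ordinal T0)); rewrite /w !enum_valK.
Qed.

(** The value of [s] on the face through the dart [a], written as a sum to avoid choosing an index
    for that face. *)
Definition potential (s : 'rV[K]_#|faces e rho|) (a : T * T) : K :=
  \sum_f s 0 f * (face_of rho a == enum_val f)%:R.

Lemma potential_step s a : potential s (face_step rho a) = potential s a.
Proof. by rewrite /potential; under eq_bigr do rewrite face_of_step. Qed.

Lemma potential_face s a f : face_of rho a = enum_val f -> potential s a = s 0 f.
Proof.
move=> af; rewrite /potential (bigD1 f) //= af eqxx mulr1 big1 ?addr0 // => g gf.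
by rewrite (inj_eq enum_val_inj) eq_sym (negbTE gf) mulr0.
Qed.

Lemma mul_boundary s u v i : e u v -> enum_val i = [set u; v] ->
  (s *m boundary) 0 i = potential s (u, v) + potential s (v, u).
Proof.
move=> uv iE; rewrite mxE -(sum_edge_darts (potential s) uv) exchange_big /=.
apply: eq_bigr => f _; rewrite mxE big_distrr /=.
by apply: eq_bigl => a; rewrite iE.
Qed.

(** For [s] in the kernel, the two darts of an edge have equal potential; face steps carry it around
    each vertex, and connectedness over the whole graph. *)
Lemma rank_boundary : (#|faces e rho|.-1 <= \rank boundary)%N.
Proof.
apply: constant_ker_rank => s s0.
have swap u v : e u v -> potential s (u, v) = potential s (v, u).
  move=> uv; apply: F2_add_eq0; have [i iE] := edge_index uv.
  by rewrite -(mul_boundary s uv iE) s0 mxE.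
have around v u u' : e v u -> e v u' -> potential s (v, u) = potential s (v, u').
  move=> vu; rewrite (rot _ vu) => /porbitP[k ->].
  elim: k => [|k IH]; first by rewrite expg0 perm1.
  rewrite expgSr permM IH swap; last by rewrite (rot _ vu) mem_porbit.
  exact/esym/(potential_step s (_, v)).
pose w v := if [pick u | e v u] is Some u then potential s (v, u) else 0.
have wE v u : e v u -> w v = potential s (v, u).
  by rewrite /w => vu; case: pickP => [u' vu'|/(_ u)]; [apply: around|rewrite vu].
have wc : forall u v, w u = w v.
  by apply: connected_const => u v uv; rewrite (wE _ _ uv) swap // -wE // e_sym.
have sE f : exists v, s 0 f = w v.
  have /imsetP[[u v]] := enum_valP f; rewrite inE /= => uv fE.
  by exists u; rewrite (wE _ _ uv); apply/esym/potential_face.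
have [F0|F0] := posnP #|faces e rho|.
  by exists 0; apply/rowP => j; have := leq_trans (ltn_ord j) (eq_leq F0).
exists (s 0 (Ordinal F0)); apply/rowP => j; rewrite [RHS]mxE.
by have [u ->] := sE j; have [v ->] := sE (Ordinal F0).
Qed.

Lemma mul_incidence m (M : 'M[K]_(m, #|edges e|)) (G : {set T} -> K) k j :
  (forall i, M k i = G (enum_val i)) ->
  (M *m incidence) k j = \sum_(u | e (enum_val j) u) G [set (enum_val j : T); u].
Proof.
move=> MG; rewrite mxE -sum_vertex_edges big_mkcondr /=.
pose H (E : {set T}) := if (enum_val j : T) \in E then G E else 0.
rewrite (eq_bigr (fun i => H (enum_val i))); first by rewrite -(big_enum_val H).
by move=> i _; rewrite MG !mxE /H; case: (_ \in _); rewrite ?mulr1 ?mulr0.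
Qed.

(** A facial walk that enters [v] along [(u, v)] leaves along [(v, rho v u)], so its incidences at
    [v] cancel in pairs. *)
Lemma boundary_incidence : boundary *m incidence = 0.
Proof.
apply/matrixP => f j; set v := enum_val j : T.
pose phi a : K := (face_of rho a == enum_val f)%:R.
rewrite (@mul_incidence _ _
  (fun E => \sum_(a in darts e | [set a.1; a.2] == E) phi a)); last by move=> i; rewrite mxE.
rewrite (eq_bigr (fun u => phi (v, u) + phi (v, rho v u))) => [|u vu]; last first.
  by rewrite sum_edge_darts // /phi -(face_of_step (u, v)).
rewrite big_split /= [X in X + _](reindex_inj (@perm_inj _ (rho v))) /=.
rewrite (eq_bigl (fun u => e v u)) => [|u].
  by rewrite mxE; apply/eqP/negPn; rewrite F2_addE addbb.
by apply/idP/idP => [/nbr_rho|/rho_nbr].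
Qed.

(* Euler's formula makes the face boundaries span the cycle space mod 2, so every
   even subgraph Z two-colours the faces. *)
Lemma cycle_potential (Z : rel T) : symmetric Z -> subrel Z e ->
  (forall v, \big[addb/false]_u Z v u = false) ->
  exists S : T * T -> bool, (forall a, S (face_step rho a) = S a) /\
    forall u v, e u v -> Z u v = S (u, v) (+) S (v, u).
Proof.
move=> Zsym Ze Zev.
pose G E : K := [exists a, (a \in darts e) && ([set a.1; a.2] == E) && Z a.1 a.2]%:R.
have GE u v : e u v -> G [set u; v] = (Z u v)%:R.
  move=> uv; congr (nat_of_bool _)%:R; apply/existsP/idP => [[[a b]]|Zuv].
    case/andP=> /andP[]; rewrite inE /= => ab /eqP abE Zab.
    have : u \in [set a; b] by rewrite abE !inE eqxx.
    have : v \in [set a; b] by rewrite abE !inE eqxx orbT.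
    rewrite !inE => /orP[] /eqP vE /orP[] /eqP uE; move: uv; rewrite uE vE ?e_irr //.
    by rewrite Zsym.
  by exists (u, v); rewrite inE uv eqxx.
pose z : 'rV[K]_#|edges e| := \row_i G (enum_val i).
have zI : z *m incidence = 0.
  apply/rowP => j; rewrite (@mul_incidence _ _ G); last by move=> i; rewrite mxE.
  rewrite (eq_bigr (fun u => (Z (enum_val j) u)%:R)) => [|u]; last exact: GE.
  rewrite mxE big_mkcond /= (eq_bigr (fun u => (Z (enum_val j) u)%:R)) => [|u _]; last first.
    by case: ifP => // /negbT; apply: contraNeq => h; apply: Ze; case: (Z _ _) h.
  have /(congr1 (fun b : bool => b%:R : K)) := Zev (enum_val j).
  rewrite (big_morph (fun b : bool => b%:R : K) (id1 := 0) (op1 := +%R)) //.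
  by move=> [] []; apply/val_inj.
(* By Euler's formula the kernel of [incidence] has dimension at most [#|faces e rho|.-1], a lower
   bound for the rank of [boundary]. *)
have sub : (kermx incidence <= boundary)%MS.
  have BK : (boundary <= kermx incidence)%MS by apply/sub_kermxP/boundary_incidence.
  rewrite -(geq_leqif (mxrank_leqif_sup BK)) mxrank_ker.
  have := rank_incidence; have := rank_boundary; move: euler; lia.
have /submxP[s sE] : (z <= boundary)%MS by apply: submx_trans sub; apply/sub_kermxP.
exists (fun a => potential s a != 0); split=> [a|u v uv]; first by rewrite potential_step.
rewrite -F2_addE; have [i iE] := edge_index uv.
rewrite -(mul_boundary s uv iE) -sE mxE iE GE //; by case: (Z u v).
Qed.

End Potential.

(** * The outer walk as a Hamiltonian cycle without crossing chords *)

Section OuterCycle.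
Local Open Scope nat_scope.
Variables (T : finType) (e : rel T) (rho : T -> {perm T}) (a0 : T * T).
Hypotheses (e_sym : symmetric e) (e_irr : irreflexive e).
Hypothesis e_conn : forall x y, connect e x y.
Hypothesis rot : rotation_system e rho.
Hypothesis euler : #|T| + #|faces e rho| = #|edges e| + 2.
Hypothesis two_conn : forall v a b, a != v -> b != v ->
  connect [rel u w | [&& u != v, w != v & e u w]] a b.
Hypothesis a0_dart : e a0.1 a0.2.
Hypothesis outer : forall v, exists u, fconnect (face_step rho) a0 (v, u).

Let outer_dart v u := fconnect (face_step rho) a0 (v, u).

Definition single_edge (x y : T) : rel T :=
  fun u w => (u == x) && (w == y) || (u == y) && (w == x).

Lemma single_edge_sym x y : symmetric (single_edge x y).
Proof.
by move=> u w; rewrite /single_edge orbC; congr (_ || _); apply: andbC.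
Qed.

Lemma big_addb_eq (x : T) : \big[addb/false]_u (u == x) = true.
Proof. by rewrite (bigD1 x) //= eqxx big1 // => u /negbTE. Qed.

Lemma single_edge_parity x y v : x != y ->
  \big[addb/false]_u single_edge x y v u = (v == x) (+) (v == y).
Proof.
move=> xy; rewrite /single_edge; have [->|vx] := eqVneq v x.
  rewrite (negbTE xy) /=; under eq_bigr do rewrite orbF.
  exact: big_addb_eq.
have [_|_] := eqVneq v y; last by rewrite big1.
exact: big_addb_eq.
Qed.

(** The edges of a walk are added modulo 2: repeated ones cancel, and only the ends can keep odd
    degree. *)
Lemma connect_parity (r : rel T) a b : symmetric r -> irreflexive r -> connect r a b ->
  exists Z : rel T, [/\ symmetric Z, subrel Z r &
    forall v, \big[addb/false]_u Z v u = (v == a) (+) (v == b)].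
Proof.
move=> r_sym r_irr /connectP[p + ->]; elim: p a => [|c p IH] a /=.
  by move=> _; exists (fun _ _ => false); split=> // v; rewrite addbb big1.
case/andP=> ac /IH[Z [Zs Zr Zp]].
have aNc : a != c by apply: contraTneq ac => ->; rewrite r_irr.
exists (fun u w => Z u w (+) single_edge a c u w); split.
- by move=> u w; rewrite Zs single_edge_sym.
- move=> u w; case: (boolP (single_edge a c u w)); last by rewrite addbF => _ /Zr.
  by case/orP=> /andP[/eqP -> /eqP ->] _ //; rewrite r_sym.
- move=> v; rewrite big_split /= Zp single_edge_parity //.
  by case: (v == a); case: (v == c); case: (v == _).
Qed.

(** Take the first visit to [b]; a return to [a] on the way would yield an earlier one. *)
Lemma perm_turn (p : {perm T}) a b : b \in porbit p a -> a != b ->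
  exists k, [/\ b = iter k.+1 p a, forall i, i < k -> iter i.+1 p a != b &
    forall i, i <= k -> iter i.+1 p a != a].
Proof.
move=> /porbitP[m mE] ab.
have ex : exists k, iter k p a == b by exists m; rewrite mE permX.
case: (ex_minnP ex) => -[/eqP /= h|k /eqP kE kmin]; first by rewrite h eqxx in ab.
exists k; split=> // i ik.
  by apply/eqP => /eqP /kmin; lia.
apply/eqP => iE; have : iter (k - i) p a == b.
  by rewrite -{1}iE -iterD addnS subnK // kE.
by move/kmin; lia.
Qed.

Section Walk.
Variables (Z : rel T) (S : T * T -> bool).
Hypothesis S_step : forall a, S (face_step rho a) = S a.
Hypothesis S_Z : forall u v, e u v -> Z u v = S (u, v) (+) S (v, u).

Lemma S_rho v u : e v u -> S (v, rho v u) = S (v, u) (+) Z v u.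
Proof. by move=> vu; rewrite S_Z // addKb; apply: (S_step (u, v)). Qed.

Lemma S_outer v u v' u' : outer_dart v u -> outer_dart v' u' -> S (v, u) = S (v', u').
Proof.
have S0 a : fconnect (face_step rho) a0 a -> S a = S a0.
  move=> /iter_findex <-; elim: (findex _ _ _) => //= k <-; exact: S_step.
by move=> /S0 -> /S0 ->.
Qed.

(** Turning around [v] changes the colour only across edges of [Z], and here only the first edge
    [va] can be one. *)
Lemma S_turn v a k : e v a -> (forall i, i < k -> Z v (iter i.+1 (rho v) a) = false) ->
  S (v, iter k.+1 (rho v) a) = S (v, a) (+) Z v a.
Proof.
move=> va; elim: k => [_|k IH Zk]; first exact: S_rho.
rewrite iterS S_rho; last by rewrite (rot _ va) -permX mem_porbit.
by rewrite IH ?Zk ?addbF // => i ik; apply: Zk; apply: leqW.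
Qed.

End Walk.

Lemma outer_dart_edge v u : outer_dart v u -> e v u.
Proof.
move=> /iter_findex h; rewrite -[v]/(v, u).1 -[in X in e _ X]/(v, u).2 -h.
by elim: (findex _ _ _) => //= k; exact: (face_step_dart e_sym rot).
Qed.

(* If v had two corners on the outer face, a cycle through v that separates them
   would have the outer face on both sides. *)
Lemma outer_unique v a b : outer_dart v a -> outer_dart v b -> a = b.
Proof.
move=> oa ob; apply/eqP/negPn/negP => ab.
have va := outer_dart_edge oa; have vb := outer_dart_edge ob.
have aNv : a != v by apply: contraTneq va => ->; rewrite e_irr.
have bNv : b != v by apply: contraTneq vb => ->; rewrite e_irr.
have [||Z' [Zs Zr Zp]] := connect_parity _ _ (two_conn aNv bNv).
- by move=> u w /=; rewrite e_sym andbCA.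
- by move=> u /=; rewrite e_irr !andbF.
(* A connection from [a] to [b] avoiding [v], completed by the edges [va] and [vb] to an even
   subgraph. *)
pose Z : rel T := fun u w => Z' u w (+) (single_edge v a u w (+) single_edge v b u w).
have [||w|S [Sstep SZ]] := @cycle_potential _ e rho e_sym e_irr e_conn rot euler Z.
- by move=> u w; rewrite /Z Zs !(single_edge_sym _ _ u).
- move=> u w; rewrite /Z.
  have [/Zr/and3P[_ _ //]|_] := boolP (Z' u w); rewrite addFb.
  have [/orP[] /andP[/eqP -> /eqP ->] _|_] := boolP (single_edge v a u w); rewrite ?va 1?e_sym //.
  by have [/orP[] /andP[/eqP -> /eqP ->] _|//] := boolP (single_edge v b u w); rewrite ?vb 1?e_sym.
- rewrite !big_split /= Zp !single_edge_parity; try by rewrite eq_sym.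
  by case: (w == a); case: (w == b); case: (w == v).
have Zv w : Z v w = (w == a) (+) (w == b).
  rewrite /Z /single_edge !eqxx /= ![v == _]eq_sym (negbTE aNv) (negbTE bNv) !orbF.
  by have [/Zr|//] := boolP (Z' v w); rewrite /= eqxx.
(* The turn from [a] to [b] crosses [Z] exactly once, yet both corners belong to the outer face. *)
have [|k [kE kb ka]] := @perm_turn (rho v) a b _ ab; first by rewrite -(rot _ va).
have := S_turn Sstep SZ va (k := k); rewrite -kE Zv eqxx (negbTE ab) => h.
have /h : forall i, i < k -> Z v (iter i.+1 (rho v) a) = false.
  by move=> i ik; rewrite Zv (negbTE (kb i ik)) (negbTE (ka i (ltnW ik))).
by rewrite (S_outer Sstep oa ob); case: (S _).
Qed.

Definition outer_next v : T := odflt v [pick u | fconnect (face_step rho) a0 (v, u)].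

Definition outer_index v : nat := findex (face_step rho) a0 (v, outer_next v).

Lemma outer_nextP v : outer_dart v (outer_next v).
Proof.
rewrite /outer_next; case: pickP => [//|none] /=.
by have [u] := outer v; rewrite none.
Qed.

Lemma iter_outer_index v : iter (outer_index v) (face_step rho) a0 = (v, outer_next v).
Proof. exact/iter_findex/outer_nextP. Qed.

Lemma outer_index_inj : injective outer_index.
Proof.
by move=> u v uv; have := iter_outer_index u; rewrite uv iter_outer_index => -[].
Qed.

(** By [outer_unique], each vertex is left exactly once by the outer walk. *)
Lemma order_outer : fingraph.order (face_step rho) a0 = #|T|.
Proof.
have inj : injective (fun v => (v, outer_next v)) by move=> u v [].
rewrite -(card_codom inj); apply: eq_card => -[v u].
apply/idP/codomP => [vu|[w ->]]; last exact: outer_nextP.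
by exists v; rewrite (outer_unique vu (outer_nextP v)).
Qed.

Lemma outer_index_lt v : outer_index v < #|T|.
Proof. by rewrite -order_outer; apply/findex_max/outer_nextP. Qed.

Lemma outer_index_next x y :
  outer_index y = (outer_index x).+1 %% #|T| -> y = outer_next x.
Proof.
move=> yE; have := iter_outer_index y; rewrite yE => h.
have per k q : iter (q * #|T| + k) (face_step rho) a0 = iter k (face_step rho) a0.
  elim: q => [//|q IH]; rewrite mulSn -addnA addnC iterD -order_outer.
  by rewrite iter_order ?order_outer //; apply: face_step_inj.
have : iter (outer_index x).+1 (face_step rho) a0 = (y, outer_next y).
  by rewrite -h [in LHS](divn_eq (outer_index x).+1 #|T|) per.
by rewrite iterS iter_outer_index /face_step /= => -[].
Qed.

Lemma outer_index_surj k : k < #|T| -> exists v, outer_index v = k.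
Proof. exact: (idx_surj outer_index_inj outer_index_lt). Qed.

(* [t] lies off the cycle formed by the chord xy and the outer arc from x to y,
   hence outside of it, while the chords at [z] run inside of it. *)
Lemma outer_noncrossing x y z t :
  outer_index x < outer_index z -> outer_index z < outer_index y ->
  outer_index y < outer_index t -> e x y -> e z t -> False.
Proof.
set idx := outer_index => xz zy yt exy ezt.
have idx_inj : injective idx := outer_index_inj.
have next_e u w : idx w = (idx u).+1 -> w = outer_next u /\ e u w.
  move=> h; have -> : w = outer_next u.
    by apply: outer_index_next; rewrite modn_small -?/idx -?h ?outer_index_lt.
  by split=> //; apply: outer_dart_edge (outer_nextP u).
pose up u w := [&& idx w == (idx u).+1, idx x <= idx u & idx w <= idx y].
pose Z : rel T := fun u w => up u w (+) up w u (+) single_edge x y u w.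
have xNy : x != y by apply: contraTneq (ltn_trans xz zy) => ->; rewrite ltnn.
have ylt : idx y < #|T| := outer_index_lt y.
have up_parity v : \big[addb/false]_w up v w = (idx x <= idx v < idx y).
  have [/andP[xv vy]|N] := boolP (_ && _); last first.
    by rewrite big1 // => w _; apply: contraNF N => /and3P[/eqP -> -> ->].
  have [w wE] : exists w, idx w = (idx v).+1 := outer_index_surj (leq_ltn_trans vy ylt).
  transitivity (\big[addb/false]_u (u == w)); last exact: big_addb_eq.
  apply: eq_bigr => u _.
  by rewrite /up -(inj_eq idx_inj) wE; lia.
have down_parity v : \big[addb/false]_w up w v = (idx x < idx v <= idx y).
  have [/andP[xv vy]|N] := boolP (_ && _); last first.
    by rewrite big1 // => w _; apply: contraNF N => /and3P[/eqP -> ? ?]; rewrite ltnS; apply/andP.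
  have [w wE] : exists w, idx w = (idx v).-1.
    by apply: outer_index_surj; have := outer_index_lt v; rewrite -/idx; lia.
  transitivity (\big[addb/false]_u (u == w)); last exact: big_addb_eq.
  apply: eq_bigr => u _.
  by rewrite /up -(inj_eq idx_inj); lia.
have [||v|S [Sstep SZ]] := @cycle_potential _ e rho e_sym e_irr e_conn rot euler Z.
- by move=> u w; rewrite /Z single_edge_sym; congr (_ (+) _); apply: addbC.
- move=> u w; rewrite /Z.
  have [/and3P[/eqP /next_e[_ //]]|_] := boolP (up u w).
  have [/and3P[/eqP /next_e[_]]|_] := boolP (up w u); first by rewrite e_sym.
  by have [/orP[] /andP[/eqP -> /eqP ->]|//] := boolP (single_edge x y u w); rewrite ?[e y x]e_sym.
- rewrite !big_split /= up_parity down_parity single_edge_parity // -!(inj_eq idx_inj).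
  by lia.
have zlt : 0 < idx z by lia.
have [z'' z''E] : exists w, idx w = (idx z).-1.
  by apply: outer_index_surj; have := outer_index_lt z; rewrite -/idx; lia.
have [zE _] : z = outer_next z'' /\ e z'' z by apply: next_e; lia.
have [z' z'E] : exists w, idx w = (idx z).+1 by apply: outer_index_surj; lia.
have [z'n zz'] := next_e _ _ z'E.
(* The outer walk passes from [z''] through [z] to [z'], so [z'] directly follows [z''] in the
   rotation at [z]. *)
have rz : rho z z'' = z'.
  have : outer_dart z (rho z z'').
    apply: connect_trans (outer_nextP z'') _; rewrite -zE.
    exact: (fconnect1 (face_step rho) (z'', z)).
  by move=> o; rewrite z'n; apply: outer_unique o (outer_nextP z).
have Zz w : Z z w = (w == z') (+) (w == z'').
  rewrite /Z /up /single_edge -!(inj_eq idx_inj); lia.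
have Zt w : Z t w = false.
  rewrite /Z /up /single_edge -!(inj_eq idx_inj); lia.
have tz' : z' != t by rewrite -(inj_eq idx_inj); lia.
have [|k [kE kt kz']] := @perm_turn (rho z) z' t _ tz'; first by rewrite -(rot _ zz').
(* Meeting [z''] before [t] would lead straight back to [z'], so the turn crosses [Z] only at
   [z']. *)
have St : S (z, t) = ~~ S (z, z').
  have := S_turn Sstep SZ zz' (k := k); rewrite -kE Zz eqxx.
  have /negbTE -> : z' != z'' by rewrite -(inj_eq idx_inj); lia.
  rewrite addbT; apply=> i ik; rewrite Zz (negbTE (kz' i (ltnW ik))).
  by apply: contraNF (kz' i.+1 ik) => /eqP iE; rewrite iterS iE rz.
have etz : e t z by rewrite e_sym.
(* No edge of [Z] meets [t], so all corners at [t] have the colour of the outer face. *)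
have Stz : S (t, z) = S (z, z').
  rewrite z'n (S_outer Sstep (outer_nextP z) (outer_nextP t)).
  have [->//|nz] := eqVneq z (outer_next t).
  have ett := outer_dart_edge (outer_nextP t); rewrite eq_sym in nz.
  have [|m [mE _ _]] := @perm_turn (rho t) (outer_next t) z _ nz.
    by rewrite -(rot _ ett).
  by rewrite mE (S_turn Sstep SZ ett) ?Zt ?addbF.
by have := SZ _ _ etz; rewrite Zt St Stz; case: (S _).
Qed.

End OuterCycle.

(** * From a 2-connected outerplanar embedding to a noncrossing cyclic order *)

Theorem theorem1p3 (T : finType) (e : rel T) :
  simple_graph e ->
  k_connected e 2 ->
  outerplanar e ->
  ~ is_odd_cycle e ->
  truncated_degree_AT 5 e.
Proof.
move=> [e_sym e_irr] [T2 conn] [rho [O [[rot euler] [Of Oc] Ov]]] notodd.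
have e_conn x y : connect e x y.
  have := conn set0; rewrite cards0 => /(_ isT x y); rewrite !inE => /(_ isT isT).
  by apply: connect_sub => u w /= /and3P[_ _ uw]; apply: connect1.
have two_conn v a b : a != v -> b != v ->
    connect [rel u w | [&& u != v, w != v & e u w]] a b.
  move=> av bv; have := conn [set v]; rewrite cards1 => /(_ isT a b); rewrite !inE.
  move=> /(_ av bv); apply: connect_sub => u w /=; rewrite !inE => uw.
  exact: connect1.
have nbr v : exists u, e v u.
  have /card_gt0P[w] : 0 < #|[set~ v]| by rewrite cardsC1; lia.
  rewrite !inE => wv; have /connectP[[|u p] /=] := e_conn v w.
    by move=> _ wE; rewrite wE eqxx in wv.
  by case/andP=> vu _ _; exists u.
have niT : non_isolated e = setT.
  apply/setP => v; rewrite !inE; have [u vu] := nbr v.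
  by apply/card_gt0P; exists u; rewrite inE.
have /card_gt0P[v0 _] : 0 < #|T| by lia.
have nc1 : n_comp e (non_isolated e) = 1.
  rewrite -(n_comp_connect (e := e) _ v0).
    by apply: eq_n_comp_r => v; rewrite niT inE /in_mem /= e_conn.
  by move=> u v; rewrite !e_conn.
have eulerT : #|T| + #|faces e rho| = #|edges e| + 2.
  by move: euler; rewrite nc1 niT cardsT muln1.
have [A [a [AO aA _]]] : exists A a, [/\ A \in O, a \in A & a.1 = v0].
  by apply: Ov; rewrite niT inE.
have /imsetP[a0] := subsetP Of A AO; rewrite inE => a0_dart AE.
have outer v : exists u, fconnect (face_step rho) a0 (v, u).
  have [B [[b1 b2] [BO bB /= bv]]] : exists A a, [/\ A \in O, a \in A & a.1 = v].
    by apply: Ov; rewrite niT inE.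
  (* The graph is connected, so all outer walks coincide with the single face of [a0]. *)
  have BA := Oc B A BO AO _ _ bB aA (e_conn _ _).
  by exists b2; move: bB; rewrite BA AE inE bv.
apply: (@noncrossing_AT _ _ (outer_index rho a0)) => //.
- exact: outer_index_inj.
- exact: (outer_index_lt e_sym e_irr e_conn rot eulerT two_conn a0_dart outer).
- move=> x y /(outer_index_next e_sym e_irr e_conn rot eulerT two_conn a0_dart outer) ->.
  exact: (outer_dart_edge e_sym rot a0_dart (outer_nextP outer x)).
- exact: (outer_noncrossing e_sym e_irr e_conn rot eulerT two_conn a0_dart outer).
Qed.
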